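(* Let $\Omega,\Omega'\subset\mathbb{R}^d$ be open and let $M\in L(C^\infty(\Omega),C^\infty(\Omega'))$. The following are equivalent: 1. There is $T\in\mathscr{E}'(V(\Omega',\Omega))$ such that $M=N_T^*$, the transpose of $N_T:\mathscr{E}'(\Omega')\to\mathscr{E}'(\Omega)$. 2. There is $T\in\mathscr{E}'(V(\Omega',\Omega))$ such that $M=M_T$. 3. $M$ admits all monomials as eigenvectors, i.e. for every $\alpha\in\mathbb{N}_0^d$ there is $m_\alpha\in\mathbb{C}$ such that $M(x^\alpha|_\Omega)=m_\alpha x^\alpha|_{\Omega'}$.
   Context: For $x,y\in\mathbb{R}^d$, $xy=(x_1y_1,\dots,x_dy_d)$. $L(E,F)$ is the space of continuous linear maps $E\to F$; $C^\infty(\Omega)$ carries its usual Fréchet topology and $\mathscr{E}'(\Omega)$ is its strong dual (distributions with compact support in $\Omega$, regarded as a subset of $\mathscr{E}'(\mathbb{R}^d)$). $V(\Omega',\Omega)=\{\eta\in\mathbb{R}^d:\eta\Omega'\subset\Omega\}$. For an arbitrary set $A\subset\mathbb{R}^d$, $\mathscr{E}'(A)$ denotes the set of distributions on $\mathbb{R}^d$ whose support is compact and contained in $A$. For $T,S\in\mathscr{E}'(\mathbb{R}^d)$, $(T\star S)f=T_x(S_yf(xy))$ for $f\in C^\infty(\mathbb{R}^d)$. For $T\in\mathscr{E}'(V(\Omega',\Omega))$ the map $N_T:S\mapsto T\star S$ belongs to $L(\mathscr{E}'(\Omega'),\mathscr{E}'(\Omega))$; its transpose $N_T^*$ is regarded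 (by reflexivity) as a map $C^\infty(\Omega)\to C^\infty(\Omega')$. For such $T$, $(M_Tf)(x)=T_y f(xy)$ for $f\in C^\infty(\Omega)$, $x\in\Omega'$ (note that $y\mapsto f(xy)$ is defined and smooth on the open set $\{y:xy\in\Omega\}\supset\operatorname{supp}T$). *)

(* Defs.v *)
From HB Require Import structures.
From mathcomp Require Import all_boot all_order all_algebra complex.
From mathcomp Require Import all_classical all_reals all_analysis.

Set Implicit Arguments.
Unset Strict Implicit.
Unset Printing Implicit Defensive.

Import Order.TTheory GRing.Theory Num.Theory.
Import numFieldNormedType.Exports.

Local Open Scope classical_set_scope.
Local Open Scope ring_scope.

Section Derivatives.
Context {R : realType} {d : nat}.
Local Notation E := 'rV[R]_d.
Local Notation C := (R[i]^o).
Implicit Types (f g : E -> C) (x : E) (i : 'I_d) (A : set E).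

Definition pderivable i f x : Prop :=
  derivable (fun y => complex.Re (f y)) x (delta_mx 0 i) /\
  derivable (fun y => complex.Im (f y)) x (delta_mx 0 i).

Definition pderiv i f : E -> C := fun x =>
  Complex ('D_(delta_mx 0 i) (fun y => complex.Re (f y)) x)
          ('D_(delta_mx 0 i) (fun y => complex.Im (f y)) x).

(* A differential operator of order n is given by a word of length n in the
   coordinate directions; its letters act from right to left. *)
Definition pderivs (s : seq 'I_d) f : E -> C := foldr pderiv f s.

Definition smooth_on A f : Prop :=
  forall (s : seq 'I_d) x, A x ->
    {for x, continuous (pderivs s f)} /\
    forall i, pderivable i (pderivs s f) x.

Definition is_pderiv i f x (l : C) : Prop :=
  is_derive x (delta_mx 0 i : E) (fun y => complex.Re (f y) : R) (complex.Re l) /\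
  is_derive x (delta_mx 0 i : E) (fun y => complex.Im (f y) : R) (complex.Im l).

Lemma is_pderivP i f x : pderivable i f x -> is_pderiv i f x (pderiv i f x).
Proof. by move=> [? ?]; split; split. Qed.

Lemma is_pderiv_able i f x l : is_pderiv i f x l -> pderivable i f x.
Proof. by move=> [[? _] [? _]]; split. Qed.

Lemma is_pderiv_val i f x l : is_pderiv i f x l -> pderiv i f x = l.
Proof. by move=> [[_ h] [_ k]]; rewrite /pderiv h k; case: l {h k}. Qed.

Lemma is_pderiv_near i f g x l : {near nbhs x, f =1 g} ->
  is_pderiv i f x l -> is_pderiv i g x l.
Proof.
move=> fg [h k]; split.
  apply: near_eq_is_derive h => //; by near=> y; congr complex.Re; near: y.
apply: near_eq_is_derive k => //; by near=> y; congr complex.Im; near: y.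
Unshelve. all: by end_near. Qed.

Lemma smooth_onP A f (D : seq 'I_d -> E -> C) : open A ->
  {in A, D [::] =1 f} ->
  (forall s x, A x -> {for x, continuous (D s)}) ->
  (forall s i x, A x -> is_pderiv i (D s) x (D (i :: s) x)) ->
  smooth_on A f /\ (forall s x, A x -> pderivs s f x = D s x).
Proof.
move=> oA D0 Dc Dd.
have key s : {in A, pderivs s f =1 D s}.
  elim: s => [|i s IH] x xA; first by rewrite D0.
  apply: is_pderiv_val; apply: is_pderiv_near (Dd s i x _); last exact/set_mem.
  near=> y; apply/esym/IH/mem_set; near: y.
  by apply: open_nbhs_nbhs; split => //; exact/set_mem.
have near_eq s x : A x -> {near nbhs x, D s =1 pderivs s f}.
  move=> Ax; near=> y; apply/esym/key/mem_set; near: y.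
  by apply: open_nbhs_nbhs; split.
split=> [s x Ax|s x /mem_set]; last exact: key.
split=> [|i]; last first.
  by apply: is_pderiv_able; apply: is_pderiv_near (Dd s i x Ax); exact: near_eq.
rewrite /prop_for /continuous_at key; last exact/mem_set.
apply: cvg_trans (Dc s x Ax).
exact: (@near_eq_cvg _ _ (nbhs x) _ _ _ (near_eq s x Ax)).
Unshelve. all: by end_near. Qed.

Lemma smooth_on_pderiv A f : smooth_on A f -> forall s i x, A x ->
  is_pderiv i (pderivs s f) x (pderivs (i :: s) f x).
Proof. by move=> sf s i x /(sf s)[_ /(_ i)]; exact: is_pderivP. Qed.

Lemma Re_lin (a : R[i]) (u v : C) : complex.Re (a *: u + v) =
  complex.Re a * complex.Re u - complex.Im a * complex.Im u + complex.Re v.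
Proof. by case: a u v => [? ?] [? ?] [? ?]. Qed.

Lemma Im_lin (a : R[i]) (u v : C) : complex.Im (a *: u + v) =
  complex.Re a * complex.Im u + complex.Im a * complex.Re u + complex.Im v.
Proof. by case: a u v => [? ?] [? ?] [? ?]. Qed.

Lemma is_pderiv_lin i f g x k l (a : R[i]) :
  is_pderiv i f x k -> is_pderiv i g x l ->
  is_pderiv i (a *: f + g) x (a *: k + l).
Proof.
move=> [f1 f2] [g1 g2]; split.
  rewrite Re_lin (_ : (fun y => complex.Re ((a *: f + g) y)) =
    (complex.Re a \*: (fun y => complex.Re (f y) : R)) -
    (complex.Im a \*: (fun y => complex.Im (f y) : R)) +
    (fun y => complex.Re (g y) : R)); last by apply/funext => y; exact: Re_lin.
  by apply: is_deriveD; apply: is_deriveB; exact: is_deriveZ.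
rewrite Im_lin (_ : (fun y => complex.Im ((a *: f + g) y)) =
  (complex.Re a \*: (fun y => complex.Im (f y) : R)) +
  (complex.Im a \*: (fun y => complex.Re (f y) : R)) +
  (fun y => complex.Im (g y) : R)); last by apply/funext => y; exact: Im_lin.
by apply: is_deriveD; apply: is_deriveD; exact: is_deriveZ.
Qed.

Lemma smooth_on_lin A f g (a : R[i]) : open A ->
  smooth_on A f -> smooth_on A g -> smooth_on A (a *: f + g).
Proof.
move=> oA sf sg.
have [] // := @smooth_onP A (a *: f + g)
  (fun s => a *: pderivs s f + pderivs s g) oA.
- move=> s x Ax.
  apply: (@cvgD _ _ _ (nbhs x)); last exact: (sg s x Ax).1.
  by apply: (@cvgZl_tmp _ _ _ (nbhs x)); exact: (sf s x Ax).1.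
- by move=> s i x Ax; exact: is_pderiv_lin (smooth_on_pderiv sf s i Ax) (smooth_on_pderiv sg s i Ax).
Qed.

Lemma smooth_on0 A : open A -> smooth_on A 0.
Proof.
move=> oA; have [] // := @smooth_onP A 0 (fun=> 0) oA.
  by move=> s x Ax; exact: (@cvg_cst _ _ _ (nbhs x)).
by move=> s i x Ax; split; exact: (is_derive_cst (0 : R)).
Qed.

End Derivatives.

Record openset (T : topologicalType) := Openset {
  openset_set :> set T;
  openset_open : open openset_set }.

Definition openT_set {T : topologicalType} : openset T := Openset openT.

Section SmoothFunctions.
Context {R : realType} {d : nat}.
Local Notation E := 'rV[R]_d.
Local Notation C := (R[i]^o).

(* A smooth function on Om is represented by its extension by 0 to the whole
   space, so that Leibniz equality is equality on Om. *)
Definition Cinf_pred (Om : openset E) : {pred E -> C} :=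
  fun f => `[< smooth_on Om f /\ forall x, ~ openset_set Om x -> f x = 0 >].

Record Cinf (Om : openset E) := MkCinf {
  Cinf_fun :> E -> C;
  Cinf_funP : Cinf_fun \in Cinf_pred Om }.

Context (Om : openset E).

HB.instance Definition _ := [isSub for @Cinf_fun Om].
HB.instance Definition _ := [Choice of Cinf Om by <:].

Lemma Cinf_submod_closed : submod_closed (Cinf_pred Om).
Proof.
split=> [|a f g].
  by apply/asboolP; split=> //; apply: smooth_on0; exact: openset_open.
move=> /asboolP[sf f0] /asboolP[sg g0]; apply/asboolP; split.
  by apply: smooth_on_lin => //; exact: openset_open.
by move=> x Ox; rewrite !fctE f0// g0// scaler0 addr0.
Qed.

HB.instance Definition _ :=
  GRing.isSubmodClosed.Build R[i] (E -> C) (Cinf_pred Om) Cinf_submod_closed.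
HB.instance Definition _ := [SubChoice_isSubLmodule of Cinf Om by <:].

Definition jet (f : Cinf Om) : prod_topology
    (fun _ : seq 'I_d => {family compactly_in Om, E -> C}) :=
  fun s => pderivs s f.

(* Uniform convergence of all derivatives on the compact subsets of Om. *)
HB.instance Definition _ := Uniform.copy (Cinf Om) (initial_topology jet).

End SmoothFunctions.

Section StrongDual.
Context {K : numFieldType}.

Definition tvs_bounded {E : preTopologicalLmodType K} (B : set E) : Prop :=
  forall U : set E, nbhs (0 : E) U ->
    exists2 r : K, 0 < r & forall a : K, r <= `|a| -> B `<=` [set a *: u | u in U].

Context (E : preTopologicalLmodType K).

Definition strong_dual_pred : {pred E -> K^o} :=
  fun phi => `[< linear phi /\ continuous phi >].

Record strong_dual := MkStrongDual {
  strong_dual_fun :> E -> K^o;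
  strong_dual_funP : strong_dual_fun \in strong_dual_pred }.

HB.instance Definition _ := [isSub for strong_dual_fun].
HB.instance Definition _ := [Choice of strong_dual by <:].

Lemma strong_dual_submod_closed : submod_closed strong_dual_pred.
Proof.
split=> [|a f g].
  apply/asboolP; split; last by move=> x; exact: cvg_cst.
  by move=> a x y; rewrite -[RHS]/(a *: 0 + 0) scaler0 addr0.
move=> /asboolP[lf cf] /asboolP[lg cg]; apply/asboolP; split.
  move=> b x y; rewrite -[LHS]/(a *: f _ + g _) lf lg -[RHS]/(b *: (a *: f x + g x) + (a *: f y + g y)).
  by rewrite !scalerDr addrACA !scalerA [a * b]mulrC.
move=> x; apply: cvgD; last exact: cg.
by apply: cvgZl_tmp; exact: cf.
Qed.

HB.instance Definition _ := GRing.isSubmodClosed.Build K (E -> K^o)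
  strong_dual_pred strong_dual_submod_closed.
HB.instance Definition _ := [SubChoice_isSubLmodule of strong_dual by <:].

Definition strong_dual_family (phi : strong_dual) :
  {family @tvs_bounded E, E -> K^o} := phi.

HB.instance Definition _ :=
  Uniform.copy strong_dual (initial_topology strong_dual_family).
End StrongDual.

Section SmoothFunctionsTheory.
Context {R : realType} {d : nat}.
Local Notation E := 'rV[R]_d.
Local Notation C := (R[i]^o).
Implicit Types Om : openset E.

Lemma initial_cvg (S : choiceType) (T : topologicalType) (w : S -> T)
    (F : set_system S) (s : S) : Filter F ->
  (F --> (s : initial_topology w)) <-> (w @ F --> w s).
Proof.
move=> FF; split=> [Fs U|ws U].
  rewrite nbhsE => -[V [oV Vs] VU]; apply: (filterS VU).
  by apply: Fs; exists (w @^-1` V); split => //; exists V.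
move=> [_ [[V oV <-] Vs] VU]; apply: (filterS VU).
by apply: ws; exact: open_nbhs_nbhs.
Qed.

Lemma Cinf_cvgP Om (F : set_system (Cinf Om)) (f : Cinf Om) : Filter F ->
  (F --> f) <-> (forall s K, compactly_in Om K ->
    {uniform K, (fun g : Cinf Om => pderivs s g) @ F --> pderivs s f}).
Proof.
move=> FF; split.
  move/initial_cvg => h s K KO; move/cvg_sup: h => /(_ s) /initial_cvg h.
  by move: h => /fam_cvgP /(_ K KO).
move=> h; apply/initial_cvg; apply/cvg_sup => s; apply/initial_cvg.
by apply/fam_cvgP => K KO; exact: h.
Qed.

(* The element of C^oo(Om) given by a function that is smooth on Om; it is 0 by
   convention when g is not smooth on Om. See toCinfE, smooth_on_monomial and
   smooth_on_hmul. *)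
Definition toCinf Om (g : E -> C) : Cinf Om :=
  insubd 0 (fun x => if x \in (Om : set E) then g x else 0).

Lemma smooth_on_eq (A : set E) (f g : E -> C) : open A -> smooth_on A f ->
  {in A, f =1 g} ->
  smooth_on A g /\ forall s x, A x -> pderivs s g x = pderivs s f x.
Proof.
move=> oA sf fg; apply: (@smooth_onP _ _ A g (fun s => pderivs s f)) => //.
- by move=> s x /(sf s)[].
- by move=> s i x Ax; exact: (smooth_on_pderiv sf s i Ax).
Qed.

Lemma toCinfE Om (g : E -> C) : smooth_on Om g ->
  {in (Om : set E), toCinf Om g =1 g}.
Proof.
move=> sg x xO; have [] := @smooth_on_eq Om g
    (fun x => if x \in (Om : set E) then g x else 0) (openset_open Om) sg.
  by move=> y yO; rewrite yO.
move=> sg' _; rewrite /toCinf insubdK ?xO//.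
by apply/asboolP; split=> // y yO; rewrite memNset.
Qed.

Lemma Cinf_smooth Om (f : Cinf Om) : smooth_on Om f.
Proof. by have /asboolP[] := Cinf_funP f. Qed.

Lemma Cinf_eqP Om (f g : Cinf Om) : {in (Om : set E), f =1 g} -> f = g.
Proof.
move=> fg; apply/val_inj/funext => x /=.
have [xO|xO] := pselect (openset_set Om x); first exact/fg/mem_set.
have /asboolP[_ ->//] := Cinf_funP f.
by have /asboolP[_ ->//] := Cinf_funP g.
Qed.

Definition restr Om (f : Cinf (@openT_set E)) : Cinf Om := toCinf Om f.

Lemma smooth_onS (A B : set E) (f : E -> C) :
  A `<=` B -> smooth_on B f -> smooth_on A f.
Proof. by move=> AB sf s x /AB; exact: sf. Qed.

Lemma restrE Om (f : Cinf (@openT_set E)) :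
  {in (Om : set E), restr Om f =1 f}.
Proof. by apply/toCinfE/(smooth_onS _ (Cinf_smooth f)). Qed.

Lemma restr_linear Om : linear (@restr Om).
Proof.
move=> a f g; apply: Cinf_eqP => x xO; rewrite restrE//.
by rewrite -[RHS]/(a *: restr Om f x + restr Om g x) !restrE.
Qed.

Lemma restr_continuous Om : continuous (@restr Om).
Proof.
move=> f; have FF : Filter (nbhs f) by exact: nbhs_filter.
apply: (@Cinf_cvgP Om (@restr Om @ f) (restr Om f) _).2 => s K [KO cK].
have /Cinf_cvgP/(_ s K) : nbhs f --> f by [].
move=> /(_ (conj (@subsetT _ _) cK)) h.
have E0 (g : Cinf (@openT_set E)) x : K x ->
    pderivs s (restr Om g) x = pderivs s g x.
  move=> /KO Ox; have sg := smooth_onS (@subsetT _ Om) (Cinf_smooth g).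
  apply: (smooth_on_eq (openset_open Om) sg _).2 => // y yO.
  by rewrite restrE.
move=> U /uniform_nbhs[W [entW WU]].
apply: (@filterS _ (nbhs f) _ [set g : Cinf (@openT_set E) |
   forall y, K y -> W (pderivs s f y, pderivs s g y)]).
  by move=> g gW; apply: WU => y Ky; rewrite !E0//; exact: gW.
apply: (h [set k | forall y, K y -> W (pderivs s f y, k y)]).
by apply/uniform_nbhs; exists W; split.
Qed.

Definition hmul (x y : E) : E := \row_i (x 0 i * y 0 i).

Definition monomial (al : 'I_d -> nat) : E -> C :=
  fun x => real_complex R (\prod_i x 0 i ^+ al i).

Lemma real_complex_continuous : continuous (real_complex R : R -> C).
Proof.
move=> x; apply/cvgrPdist_lt => /= -[e b]; rewrite ltcE /= => /andP[/eqP-> e0].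
near=> y; rewrite -rmorphB /= normc_def /= expr0n addr0 sqrtr_sqr ltcR.
by near: y; exact: cvgr_dist_lt.
Unshelve. all: by end_near. Qed.

Lemma smooth_on_coind (A : set E) (S : set (E -> C)) (f : E -> C) :
  (forall g, S g -> continuous g) ->
  (forall g i, S g -> exists2 h, S h & forall x, is_pderiv i g x (h x)) ->
  S f -> smooth_on A f.
Proof.
move=> Sc Sd Sf.
have Ss s : S (pderivs s f).
  elim: s => //= i s IH; have [h Sh hP] := Sd _ i IH.
  by rewrite (_ : pderiv _ _ = h)//; apply/funext => x; exact: is_pderiv_val.
move=> s x _; split=> [|i]; first exact: Sc.
by have [h _ /(_ x)/is_pderiv_able] := Sd _ i (Ss s).
Qed.

Lemma is_derive_line (g : E -> R) (x v : E) (l : R) :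
  is_derive (0 : R) 1 (fun h : R => g (h *: v + x)) l <-> is_derive x v g l.
Proof.
have E0 : (fun h : R => h^-1 *: (((fun h : R => g (h *: v + x)) \o shift 0)
      (h *: (1 : R)) - g (0 *: v + x))) =
    (fun h => h^-1 *: ((g \o shift x) (h *: v) - g x)).
  by apply/funext => h /=; rewrite addr0 scale0r add0r [_%:A]mulr1.
split=> -[h1 h2]; split; [move: h1|rewrite -h2|move: h1|rewrite -h2];
  by rewrite /derivable /derive E0.
Qed.

Lemma is_derive_monomial (al : 'I_d -> nat) (i : 'I_d) (x : E) :
  is_derive x (delta_mx 0 i : E) (fun y : E => \prod_j y 0 j ^+ al j : R)
    ((al i)%:R * \prod_j x 0 j ^+ (al j - (j == i))).
Proof.
apply/is_derive_line.
pose P : R := \prod_(j | j != i) x 0 j ^+ al j.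
have -> : (fun h : R => \prod_j (h *: delta_mx 0 i + x) 0 j ^+ al j : R) =
    P \*: ((id + cst (x 0 i) : R -> R) ^+ al i).
  apply/funext => h; rewrite !fctE (bigD1 i)//= !mxE !eqxx mulr1 [RHS]mulrC.
  congr (_ * _); apply: eq_bigr => j /negPf ji.
  by rewrite !mxE ji mulr0 add0r.
have d1 : is_derive (0 : R) 1 (id + cst (x 0 i) : R -> R) (1 + 0).
  exact: is_deriveD.
have dP := is_deriveZ P (is_deriveX (al i) d1).
apply: (is_derive_eq dP); rewrite !fctE add0r addr0.
rewrite (bigD1 i)//= eqxx subn1 /GRing.scale/= mulr1 [LHS]mulrC -!mulrA; congr (_ * (_ * _)).
by apply: eq_bigr => j /negPf ->; rewrite subn0.
Qed.

Lemma monomial_continuous (al : 'I_d -> nat) : continuous (monomial al).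
Proof.
move=> x; apply: (@continuous_comp _ _ _
  (fun y : E => \prod_i y 0 i ^+ al i : R) (real_complex R : R -> C)).
  elim: (index_enum _) => [|i r IH].
    rewrite (_ : (fun y : E => _) = cst (1 : R)); last first.
      by apply/funext => y; rewrite big_nil.
    exact: (@cvg_cst _ _ _ (nbhs x)).
  rewrite (_ : (fun y : E => _) = (fun y => y 0 i ^+ al i) *
    (fun y => \prod_(j <- r) y 0 j ^+ al j)); last first.
    by apply/funext => y; rewrite big_cons.
  apply: (@cvgM _ _ (nbhs x)); last exact: IH.
  apply: (@continuous_comp _ _ _ (fun y : E => y 0 i) (fun t : R => t ^+ al i)).
    exact: coord_continuous.
  exact: exprn_continuous.
exact: real_complex_continuous.
Qed.

Lemma smooth_on_monomial (A : set E) (al : 'I_d -> nat) :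
  smooth_on A (monomial al).
Proof.
pose S := [set g | exists (c : R) al, g = real_complex R c \*: monomial al].
apply: (@smooth_on_coind A S); last first.
- by exists 1, al; apply/funext => x; exact/esym/mul1r.
- move=> _ i [c [be ->]].
  pose ga j := (be j - (j == i))%N.
  exists (real_complex R (c * (be i)%:R) \*: monomial ga); first by exists (c * (be i)%:R), ga.
  move=> x; have mE (k : R) (b : 'I_d -> nat) (y : E) :
      (real_complex R k \*: monomial b : E -> C) y =
      real_complex R (k * \prod_j y 0 j ^+ b j) by rewrite rmorphM.
  split; rewrite mE.
    under eq_fun do rewrite mE.
    rewrite /= -mulrA; exact: (is_deriveZ c (is_derive_monomial be i x)).
  under eq_fun do rewrite mE.
  exact: (is_derive_cst (0 : R)).
move=> _ [c [be ->]] x.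
by apply: (@cvgZl_tmp _ _ _ (nbhs x)); exact: monomial_continuous.
Qed.

Lemma hmulC (x y : E) : hmul x y = hmul y x.
Proof. by apply/rowP => i; rewrite !mxE mulrC. Qed.

Lemma hmul_continuous (x : E) : continuous (hmul x).
Proof.
move=> y U [P Pn PU].
exists (fun i j => (fun t => x 0 j * t) @^-1` P i j).
  move=> i j; have := Pn i j; rewrite mxE ord1 => Pj.
  exact: (@mulrl_continuous R (x 0 j) (y 0 j)).
by move=> z zP; apply: PU => i j; rewrite mxE ord1; have := zP i j; rewrite ord1.
Qed.

Definition dilate_set Om (x : E) : openset E :=
  Openset (open_comp (fun y _ => @hmul_continuous x y) (openset_open Om)).

Lemma is_derive_hmul (g : E -> R) (x y : E) (i : 'I_d) (l : R) :
  is_derive (hmul x y) (delta_mx 0 i : E) g l ->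
  is_derive y (delta_mx 0 i : E) (g \o hmul x) (x 0 i * l).
Proof.
pose phi (h : R) := g (h *: delta_mx 0 i + hmul x y).
move=> /is_derive_line[dg gl]; apply/is_derive_line.
have -> : (fun h : R => (g \o hmul x) (h *: delta_mx 0 i + y)) =
    phi \o ( *%R (x 0 i)).
  apply/funext => h; congr g; apply/rowP => j; rewrite !mxE mulrDr.
  by congr (_ + _); case: (eqVneq j i) => [->|_] /=; rewrite ?mulr1 ?mulr0.
have dphi : derivable phi (x 0 i * 0) 1 by rewrite mulr0.
have dmul : derivable ( *%R (x 0 i)) (0 : R) 1.
  exact: (ex_derive (is_derive := is_deriveZ (x 0 i) (is_derive_id (0 : R) 1))).
split; first by apply/derivable1_diffP/differentiable_comp; exact/derivable1_diffP.
rewrite -derive1E derive1_comp // mulrC; congr (_ * _).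
  rewrite derive1E; have := derive_val (is_derive := is_deriveZ (x 0 i) (is_derive_id (0 : R) 1)).
  by rewrite [_%:A]mulr1.
by rewrite mulr0 derive1E.
Qed.

Lemma smooth_on_hmul Om (f : E -> C) (x : E) :
  smooth_on Om f -> smooth_on (dilate_set Om x) (f \o hmul x).
Proof.
move=> sf.
pose c (s : seq 'I_d) : R := \prod_(i <- s) x 0 i.
have [] // := @smooth_onP _ _ (dilate_set Om x) (f \o hmul x)
  (fun s => real_complex R (c s) \*: (pderivs s f \o hmul x))
  (openset_open (dilate_set Om x)).
- by move=> y _; rewrite /c big_nil; exact/mul1r.
- move=> s y yO; apply: (@cvgZl_tmp _ _ _ (nbhs y)).
  by apply: continuous_comp; [exact: hmul_continuous|exact: (sf s _ yO).1].
move=> s i y yO; have [h1 h2] := smooth_on_pderiv sf s i yO.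
have -> : (real_complex R (c (i :: s)) \*: (pderivs (i :: s) f \o hmul x)) y =
    real_complex R (c s) *: (real_complex R (x 0 i) *: pderivs (i :: s) f (hmul x y)) + 0.
  rewrite addr0 scalerA -rmorphM /c big_cons [x 0 i * _]mulrC; by [].
rewrite -[X in is_pderiv _ X]addr0; apply: is_pderiv_lin; last first.
  by split; exact: (is_derive_cst (0 : R)).
have ReM (k : R) (z : C) : complex.Re (real_complex R k *: z) = k * complex.Re z.
  by case: z => ? ? /=; rewrite mul0r subr0.
have ImM (k : R) (z : C) : complex.Im (real_complex R k *: z) = k * complex.Im z.
  by case: z => ? ? /=; rewrite mul0r addr0.
by split; [rewrite ReM|rewrite ImM]; exact: is_derive_hmul.
Qed.

End SmoothFunctionsTheory.

Section Distributions.
Context {R : realType} {d : nat}.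
Local Notation E := 'rV[R]_d.
Local Notation C := (R[i]^o).
Implicit Types (Om : openset E) (A : set E).

(* E'(Om) with its strong topology. *)
Definition distr (Om : openset E) := strong_dual (Cinf Om).

Lemma extend_subproof Om (S : distr Om) :
  (fun f => S (restr Om f)) \in @strong_dual_pred _ (Cinf (@openT_set E)).
Proof.
have /asboolP[linS contS] := strong_dual_funP S.
apply/asboolP; split=> [a f g|f]; first by rewrite restr_linear linS.
exact: (continuous_comp (@restr_continuous _ _ Om f) (contS _)).
Qed.

(* The inclusion of E'(Om) in E'(R^d). *)
Definition extend Om (S : distr Om) : distr openT_set :=
  MkStrongDual (extend_subproof S).

Definition vanishes_on (T : distr (@openT_set E)) (U : set E) : Prop :=
  forall f : Cinf (@openT_set E),
    let suppf := closure [set x | f x != 0] in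
    compact suppf -> suppf `<=` U -> T f = 0.

Definition distr_supp (T : distr (@openT_set E)) : set E :=
  ~` \bigcup_(U in [set U | open U /\ vanishes_on T U]) U.

(* E'(A) for an arbitrary set A. *)
Definition distr_in A : set (distr (@openT_set E)) :=
  [set T | compact (distr_supp T) /\ distr_supp T `<=` A].

(* V(A', A). *)
Definition dilation_set (A' A : set E) : set E :=
  [set eta | [set hmul eta x | x in A'] `<=` A].

Definition star (T S : distr (@openT_set E)) (f : Cinf (@openT_set E)) : C :=
  T (toCinf openT_set (fun x =>
     S (toCinf openT_set (fun y => f (hmul x y))))).

(* N is the map N_T : S |-> T * S, an element of L(E'(Om'), E'(Om)). *)
Definition is_star_operator Om Om' (T : distr (@openT_set E))
    (N : {linear distr Om' -> distr Om}) : Prop :=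
  continuous N /\ forall S, extend (N S) =1 star T (extend S).

(* M is the map M_T: for every x in Om', T is regarded as an element of
   E'({y | x y in Om}) before it is applied to y |-> f (x y). *)
Definition is_multiplier_operator Om Om' (T : distr (@openT_set E))
    (M : {linear Cinf Om -> Cinf Om'}) : Prop :=
  forall x, openset_set Om' x ->
    exists2 Tx : distr (dilate_set Om x), extend Tx = T &
      forall f, M f x = Tx (toCinf (dilate_set Om x) (fun y => f (hmul x y))).

End Distributions.

Section Transpose.
Context {K : numFieldType}.

(* The canonical map into the bidual. *)
Definition bidual_map {E : preTopologicalLmodType K} (f : E) :
  strong_dual E -> K^o := fun S => S f.

Definition transpose {F G : lmodType K} (N : {linear F -> G}) (phi : G -> K^o) :
  F -> K^o := phi \o N.

End Transpose.

(* Main.v *)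
Require Import Defs.
From HB Require Import structures.
From mathcomp Require Import all_boot all_order all_algebra complex.
From mathcomp Require Import all_classical all_reals all_analysis.
From mathcomp Require Import finmap ring lra.
Set Implicit Arguments.
Unset Strict Implicit.
Unset Printing Implicit Defensive.
Import Order.TTheory GRing.Theory Num.Theory.
Import numFieldNormedType.Exports.
Local Open Scope classical_set_scope.
Local Open Scope ring_scope.

(** Here x y is the componentwise product, and f (x .) the function y |-> f (x y).

    The theorem rests on one fact: a distribution with compact support in R^d
    is determined by its moments, that is by its values on the monomials
    ([moments_determine]). Indeed it is bounded by finitely many derivatives on
    a compact set, and the polynomials are dense in the smooth functions of R^d
    ([polyfun_dense]).

    Let M have the monomials as eigenvectors, with eigenvalues m_al, and let z
    be a point of Om' without zero coordinate. The distribution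
    T f = (M (f (z^-1 .))) z has the moments m_al ([has_moments_exists]). For
    every x in Om', the functionals f |-> (M f) x and f |-> T (f (x .)) then
    have the same moments m_al x^al, so they agree on the functions that are
    smooth on R^d ([has_moments_eval]). This has two consequences.
    - For x near a given point, (M f) x is controlled by the derivatives of f on
      one compact subset K of Om. When x has no zero coordinate this says that
      x supp T lies in K, and since K is closed the inclusion holds for the
      given point as well: T lies in E'(V(Om', Om)) ([has_moments_distr_in]).
    - The transpose S |-> S o M is strongly continuous, and S o M has the same
      moments as T * S, namely T(x^al) S(x^al); so it is the convolution
      operator of T ([has_moments_star]). To apply [moments_determine] to T * S
      one needs x |-> S (f (x .)) to be smooth, with derivatives that depend
      continuously on f ([hadamard_smoothP], [continuous_hadamard_Cinf]). For a
      polynomial f this function is a polynomial, and the general case follows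
      by density because locally uniform limits commute with derivatives.

    Conversely, if M is the transpose of N = (T * .), then f |-> (M f) x is the
    image of the Dirac measure at x under N, and extends to R^d as
    f |-> T (f (x .)). The support of T lies in the open set {y | x y in Om},
    hence T is the extension of a distribution T_x on that set ([localize]);
    extension is injective ([extend_inj]), therefore (M f) x = T_x (f (x .)).
    Finally such an M multiplies x^al by T(y^al).

    Localization needs cut-off functions, made from exp (-1/t). Density follows
    from Bernstein polynomials: they approximate a high mixed derivative of a
    compactly supported function uniformly, and antiderivatives of the
    approximation are close to all lower derivatives, for which the symmetry of
    the mixed derivatives is needed. *)

(** The norm of a complex number is itself complex; [cabs] is its value in R. *)
Local Notation cabs := (@ComplexField.Normc.normc _).

(** * Plateau functions on the line *)

Section Smooth1.
Context {R : realType}.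
Implicit Types (g h : R -> R) (p : {poly R}) (t : R).

(** The derivatives are part of the data, so that each closure property can name
    the derivatives that it produces. *)
Definition smooth1 g := exists2 D : nat -> R -> R, D 0%N = g &
  forall n (x : R), is_derive x 1 (D n) (D n.+1 x).

(** The smooth functions form the largest class stable under differentiation. *)
Lemma smooth1_coind (S : set (R -> R)) g :
  (forall g, S g -> exists2 h, S h & forall x : R, is_derive x 1 g (h x)) ->
  S g -> smooth1 g.
Proof.
move=> Sd Sg.
have SD n : S (iter n (fun h : R -> R => derive1 h) g).
  elim: n => //= n IH; have [h Sh hP] := Sd _ IH.
  rewrite (_ : derive1 _ = h)//; apply/funext => x.
  by rewrite derive1E; exact: (derive_val (is_derive := hP x)).
exists (fun n => iter n (fun h : R -> R => derive1 h) g) => // n x.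
have [h _ hP] := Sd _ (SD n); apply: is_derive_eq (hP x) _.
by rewrite /= derive1E (derive_val (is_derive := hP x)).
Qed.

Lemma smooth1_derive g : smooth1 g ->
  exists2 h, smooth1 h & forall x : R, is_derive x 1 g (h x).
Proof.
by move=> [D <- DD]; exists (D 1%N) => //; exists (fun n => D n.+1).
Qed.

Lemma smooth1_comp_affine g (a b : R) : smooth1 g ->
  smooth1 (fun t => g (a * t + b)).
Proof.
move=> [D D0 DD]; exists (fun n t => a ^+ n * D n (a * t + b)).
  by rewrite D0; apply/funext => t; rewrite expr0 mul1r.
move=> n x.
have dl : is_derive x 1 (fun t : R => a * t + b) a.
  apply: (is_derive_eq (is_deriveD (is_deriveZ a (is_derive_id x 1))
     (is_derive_cst b x 1))).
  by rewrite addr0 [LHS]mulr1.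
have dc := @is_derive1_comp R (D n) (fun t : R => a * t + b) x _ _ (DD n _) dl.
apply: (is_derive_eq (is_deriveZ (a ^+ n) dc)).
by rewrite /GRing.scale/= exprS; ring.
Qed.

Lemma smooth1D g h : smooth1 g -> smooth1 h -> smooth1 (g + h).
Proof.
move=> [D <- DP] [F <- FP]; exists (fun n => D n + F n) => // n x.
exact: is_deriveD.
Qed.

(** Closing the products of smooth functions under addition makes the class stable
    under differentiation. *)
Inductive sum_of_products : (R -> R) -> Prop :=
| Product g h : smooth1 g -> smooth1 h -> sum_of_products (g * h)
| Sum g h : sum_of_products g -> sum_of_products h -> sum_of_products (g + h).

Lemma smooth1M g h : smooth1 g -> smooth1 h -> smooth1 (g * h).
Proof.
move=> sg sh; apply: (@smooth1_coind [set f | sum_of_products f]); last first.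
  exact: Product.
move=> f /=; elim=> {g h sg sh f} [g h sg sh|g h _ [g' Sg gP] _ [h' Sh hP]]; last first.
  by exists (g' + h') => [|x]; [exact: Sum|exact: is_deriveD].
have [g' sg' gP] := smooth1_derive sg; have [h' sh' hP] := smooth1_derive sh.
exists (g' * h + g * h'); first by apply: Sum; exact: Product.
move=> x; apply: (is_derive_eq (is_deriveM (gP x) (hP x))).
by rewrite !fctE /GRing.scale/=; ring.
Qed.

Lemma smooth1V g : smooth1 g -> (forall t, g t != 0) ->
  smooth1 (fun t => (g t)^-1).
Proof.
move=> sg g0; have [g' sg' g'P] := smooth1_derive sg.
have sc (c : R) : smooth1 (cst c).
  apply: (@smooth1_coind [set f | exists c : R, f = cst c]); last by exists c.
  by move=> _ [k ->]; exists (cst 0); [exists 0|move=> x; exact: is_derive_cst].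
(* The quotients a / g^n are stable under differentiation. *)
pose S := [set f : R -> R | exists2 a, smooth1 a &
  exists n, f = a * (fun t => (g t)^-1) ^+ n].
apply: (@smooth1_coind S); last first.
  by exists (cst 1) => //; exists 1%N; apply/funext => t; rewrite fctE/= mul1r expr1.
move=> _ [a sa [n ->]]; have [a' sa' a'P] := smooth1_derive sa.
pose b := (fun t => a' t * g t - n%:R * a t * g' t).
exists (b * (fun t => (g t)^-1) ^+ n.+1).
  exists b; last by exists n.+1.
  rewrite (_ : b = a' * g + (cst (- n%:R) * a) * g'); last first.
    by apply/funext => t; rewrite /b !fctE/= mulNr mulNr.
  by apply: smooth1D; apply: smooth1M => //; exact: smooth1M.
move=> x.
have dV := @is_deriveV R g x (g' x) 1 (g0 x) (g'P x).
have dX := @is_deriveX _ _ (fun t => (g t)^-1) n x 1 _ dV.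
apply: (is_derive_eq (is_deriveM (a'P x) dX)).
rewrite /b !fctE /GRing.scale/=; have := g0 x.
case: n {dX b} => [|n] gx.
  by rewrite !expr0 expr1 !mul0r mulr0 add0r subr0 mul1r mulfK.
rewrite /= !exprS; field.
by rewrite gx.
Qed.

(** All derivatives of exp (-1/t) have this form, since differentiation replaces p
    by X^2 (p - p'). *)
Definition flat_fun p t : R := if 0 < t then p.[t^-1] * expR (- t^-1) else 0.

Lemma horner_bound p : exists2 C, 0 <= C &
  forall u, 1 <= u -> `|p.[u]| <= C * u ^+ size p.
Proof.
exists (\sum_(i < size p) `|p`_i|); first exact: sumr_ge0.
move=> u u1; rewrite horner_coef mulr_suml (le_trans (ler_norm_sum _ _ _))//.
apply: ler_sum => i _; rewrite normrM ler_wpM2l//.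
rewrite ger0_norm ?exprn_ge0 ?(le_trans ler01)//.
by rewrite ler_weXn2l// ltnW.
Qed.

(** One term of the series of exp (1/t), of degree size p + 2, dominates p (1/t) and
    leaves a factor t^2, which yields the derivative 0 at the origin. *)
Lemma flat_fun_bound p : exists2 C, 0 <= C &
  forall t, t <= 1 -> `|flat_fun p t| <= C * t ^+ 2.
Proof.
have [C C0 CP] := horner_bound p.
exists (C * ((size p).+2)`!%:R) => [|t t1]; first exact: mulr_ge0.
rewrite /flat_fun; case: ltP => t0; last first.
  by rewrite normr0 mulr_ge0 ?sqr_ge0 ?mulr_ge0.
have u1 : 1 <= t^-1 by rewrite invf_ge1.
have u0 : 0 <= t^-1 by rewrite (le_trans ler01).
rewrite normrM [X in _ * X]ger0_norm ?expR_ge0// expRN.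
apply: (@le_trans _ _ (C * t^-1 ^+ size p * (expR t^-1)^-1)).
  by rewrite ler_wpM2r ?invr_ge0 ?expR_ge0 ?CP.
rewrite -!mulrA ler_wpM2l//.
rewrite ler_pdivrMr ?expR_gt0//.
have h : t^-1 ^+ (size p).+2 <= expR t^-1 * (size p).+2`!%:R.
  rewrite -ler_pdivrMr ?ltr0n ?fact_gt0//.
  by apply: le_trans (expR_ge1Dxn (size p).+1 u0); rewrite lerDr.
have -> : t^-1 ^+ size p = t ^+ 2 * t^-1 ^+ (size p).+2.
  by rewrite !exprS expr0; field; rewrite gt_eqF.
rewrite [X in _ <= X](_ : _ = t ^+ 2 * (expR t^-1 * (size p).+2`!%:R)).
  by rewrite ler_wpM2l ?sqr_ge0.
by ring.
Qed.

Lemma is_derive_flat_fun p t :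
  is_derive t 1 (flat_fun p) (flat_fun ('X^2 * (p - p^`())) t).
Proof.
have [t0|t0|->] := ltgtP t 0.
- apply: (@near_eq_is_derive _ _ _ (cst 0)); last first.
    rewrite /flat_fun ltNge (ltW t0)/=; exact: is_derive_cst.
  near=> s; rewrite /flat_fun ifF//; apply/negbTE; rewrite -leNgt ltW//.
  by near: s; exact: lt_nbhsl.
- apply: (@near_eq_is_derive _ _ _ (fun t => p.[t^-1] * expR (- t^-1))); last first.
    have tn0 : t != 0 by rewrite gt_eqF.
    have dV := @is_deriveV R id t 1 1 tn0 (is_derive_id t 1).
    have d1 := @is_derive1_comp R (horner p) (fun s => s^-1) t _ _ (is_derive_poly p _) dV.
    have d2 := @is_derive1_comp R expR (fun s => - s^-1) t _ _ (is_derive_expR _) (is_deriveN dV).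
    apply: (is_derive_eq (is_deriveM d1 d2)).
    rewrite /flat_fun t0 !hornerE /= /GRing.scale/=; field.
    by rewrite tn0.
  by near=> s; rewrite /flat_fun ifT//; near: s; exact: lt_nbhsr.
- have f0 q : flat_fun q 0 = 0 by rewrite /flat_fun ltxx.
  rewrite f0; apply/is_derive1_caratheodory.
  have [C C0 CP] := flat_fun_bound p.
  (* The difference quotient at 0 is bounded by C |z|. *)
  exists (fun z => flat_fun p z / z); split.
  + move=> z; rewrite f0 !subr0; have [->|z0] := eqVneq z 0.
      by rewrite f0 mulr0.
    by rewrite divfK.
  + rewrite /prop_for/continuous_at f0 mul0r.
    apply/cvgrPdist_le => e e0; near=> z.
    rewrite sub0r normrN normrM normfV.
    have [->|z0] := eqVneq z 0; first by rewrite f0 normr0 mul0r ltW.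
    rewrite ler_pdivrMr ?normr_gt0//.
    apply: le_trans (CP z _) _.
      by near: z; apply: lt_le_nbhsl => //; exact: ltr01.
    rewrite -(real_normK (num_real z)) expr2 mulrA ler_wpM2r//.
    have zC : `|z| < e / (C + 1).
      near: z; apply: (@nbhs0_lt R R^o); rewrite divr_gt0// ltr_wpDl//.
    have C1 : 0 < C + 1 by rewrite ltr_wpDl.
    apply: (@le_trans _ _ ((C + 1) * `|z|)).
      by rewrite ler_wpM2r// lerDl.
    by rewrite mulrC -ler_pdivlMr// ltW.
  + by rewrite f0 mul0r.
Unshelve. all: by end_near. Qed.

Lemma smooth1_flat_fun p : smooth1 (flat_fun p).
Proof.
apply: (@smooth1_coind [set g | exists p, g = flat_fun p]); last by exists p.
move=> _ [q ->]; exists (flat_fun ('X^2 * (q - q^`()))); first by eexists.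
exact: is_derive_flat_fun.
Qed.

Lemma flat_fun1_ge0 t : 0 <= flat_fun 1 t.
Proof. by rewrite /flat_fun; case: ifP => // _; rewrite hornerE mul1r expR_ge0. Qed.

Lemma flat_fun1_gt0 t : 0 < t -> 0 < flat_fun 1 t.
Proof. by rewrite /flat_fun => ->; rewrite hornerE mul1r expR_gt0. Qed.

(** With a and b nonnegative, a zero on t >= 2, b zero on t <= 1 and a + b > 0, the
    quotient s = a / (a + b) falls from 1 to 0 between 1 and 2; take s (t) s (-t). *)
Lemma plateau_exists : exists2 g, smooth1 g &
  (forall t, `|t| <= 1 -> g t = 1) /\ (forall t, 2 <= `|t| -> g t = 0).
Proof.
pose a := fun t : R => flat_fun 1 ((- 1) * t + 2).
pose b := fun t : R => flat_fun 1 (1 * t + (- 1)).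
have sa : smooth1 a by exact/smooth1_comp_affine/smooth1_flat_fun.
have sb : smooth1 b by exact/smooth1_comp_affine/smooth1_flat_fun.
have ab0 t : (a + b) t != 0.
  rewrite gt_eqF// fctE; have [t2|t2] := ltP t 2.
    by rewrite ltr_wpDr ?flat_fun1_ge0// flat_fun1_gt0//; lra.
  by rewrite ltr_wpDl ?flat_fun1_ge0// flat_fun1_gt0//; lra.
pose s := a * (fun t => ((a + b) t)^-1).
have ss : smooth1 s by apply: smooth1M => //; apply: smooth1V => //; exact: smooth1D.
have s1 t : t <= 1 -> s t = 1.
  move=> t1; have b0 : b t = 0 by rewrite /b /flat_fun ifF//; apply/negbTE; rewrite -leNgt; lra.
  have := ab0 t; rewrite /s !fctE b0 addr0 => ?; exact: divff.
have s0 t : 2 <= t -> s t = 0.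
  move=> t2; have a0 : a t = 0 by rewrite /a /flat_fun ifF//; apply/negbTE; rewrite -leNgt; lra.
  by rewrite /s !fctE a0 mul0r.
exists (s * (fun t => s (-1 * t + 0))).
  by apply: smooth1M => //; exact: smooth1_comp_affine.
split=> t.
  rewrite ler_norml => /andP[t1 t2]; rewrite fctE s1// mul1r s1//; lra.
move=> t2; rewrite fctE; have [t0|t0] := leP 0 t.
  by rewrite s0 ?mul0r//; move: t2; rewrite ger0_norm.
by rewrite [X in _ * X]s0 ?mulr0//; move: t2; rewrite ltr0_norm//; lra.
Qed.

End Smooth1.

(** * Real-valued modulus, boxes and compactness *)

Section Modulus.
Context {R : realType}.
Implicit Types z w : R[i].

Lemma cabsE z : `|z| = real_complex R (cabs z).
Proof. by []. Qed.

Lemma cabs_ge0 z : 0 <= cabs z.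
Proof. by case: z => a b; exact: sqrtr_ge0. Qed.

Lemma cabs0 : cabs (0 : R[i]) = 0.
Proof. exact: ComplexField.Normc.normc0. Qed.

Lemma cabsD z w : cabs (z + w) <= cabs z + cabs w.
Proof. by rewrite -lecR rmorphD/= -!cabsE; exact: ler_normD. Qed.

Lemma cabsN z : cabs (- z) = cabs z.
Proof. by case: z => a b; rewrite /ComplexField.Normc.normc /= !sqrrN. Qed.

Lemma cabsB z w : cabs (z - w) = cabs (w - z).
Proof. by rewrite -opprB cabsN. Qed.

Lemma cabsM z w : cabs (z * w) = cabs z * cabs w.
Proof. exact: ComplexField.Normc.normcM. Qed.

Lemma cabs_real (x : R) : cabs (real_complex R x) = `|x|.
Proof. by rewrite /ComplexField.Normc.normc /= expr0n/= addr0 sqrtr_sqr. Qed.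

Lemma cabs_eq0 z : cabs z = 0 -> z = 0.
Proof. exact: ComplexField.Normc.eq0_normc. Qed.

Lemma cabs_sum (I : Type) (r : seq I) (P : pred I) (F : I -> R[i]) :
  cabs (\sum_(i <- r | P i) F i) <= \sum_(i <- r | P i) cabs (F i).
Proof.
elim/big_rec2: _ => [|i x z _ zx]; first by rewrite cabs0.
by rewrite (le_trans (cabsD _ _))// lerD2l.
Qed.

Lemma Re_le_cabs z : `|complex.Re z| <= cabs z.
Proof. by rewrite -lecR -cabsE; exact: normc_ge_Re. Qed.

Lemma Im_le_cabs z : `|complex.Im z| <= cabs z.
Proof.
case: z => a b; rewrite /ComplexField.Normc.normc /= -sqrtr_sqr ler_wsqrtr//.
by rewrite lerDr sqr_ge0.
Qed.

Lemma cabs_le z : cabs z <= `|complex.Re z| + `|complex.Im z|.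
Proof.
case: z => a b; rewrite /ComplexField.Normc.normc /= -(@ler_pXn2r _ 2)//; last 2 first.
- by rewrite nnegrE sqrtr_ge0.
- by rewrite nnegrE addr_ge0.
rewrite sqr_sqrtr ?addr_ge0 ?sqr_ge0// -[a ^+ 2]real_normK ?num_real//.
rewrite -[b ^+ 2]real_normK ?num_real// sqrrD lerD2r lerDl.
by rewrite mulrn_wge0// mulr_ge0.
Qed.

Lemma cvg_cabsP {T : Type} (F : set_system T) (f : T -> R[i]^o) (l : R[i]^o) :
  Filter F ->
  (f @ F --> l) <-> (forall e : R, 0 < e -> \forall t \near F, cabs (l - f t) < e).
Proof.
move=> FF; split=> [/cvgrPdist_lt fl e e0|fl].
  have e0' : (0 : R[i]) < real_complex R e by rewrite ltcR.
  by apply: filterS (fl _ e0') => t; rewrite cabsE ltcR.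
apply/cvgrPdist_lt => -[e b]; rewrite ltcE /= => /andP[/eqP-> e0].
by apply: filterS (fl e e0) => t; rewrite -[Complex e 0]/(real_complex R e) -ltcR -cabsE.
Qed.

End Modulus.

Section Compact.
Context {R : realType} {d : nat}.
Local Notation E := 'rV[R]_d.
Local Notation C := (R[i]^o).
Implicit Types (x y : E) (K : set E).

Lemma near_coord x (e : R) : 0 < e -> \forall y \near x, forall i, `|x 0 i - (y : E) 0 i| < e.
Proof.
move=> e0; near=> y => i; have : ball x e y by near: y; exact: nbhsx_ballx.
by case=> _ /(_ 0 i).
Unshelve. all: by end_near. Qed.

Lemma nearP_coord x (P : set E) : (\forall y \near x, P y) ->
  exists2 e : R, 0 < e & forall y, (forall i, `|x 0 i - y 0 i| < e) -> P y.
Proof.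
move/nbhs_ballP => [e /= e0 eP]; exists e => // y xy; apply: eP.
by split => // i j; rewrite ord1; exact: xy.
Qed.

Lemma continuous_cabsP x (g : E -> C) : {for x, continuous g} <->
  forall e : R, 0 < e -> \forall y \near x, cabs (g x - g y) < e.
Proof.
split=> [gx e e0|h]; first by have /cvg_cabsP/(_ e e0) := gx.
exact: ((cvg_cabsP g (g x) (nbhs_filter x)).2 h).
Qed.

Definition box (r : R) : set E := [set x | forall i, `|x 0 i| <= r].

Lemma compact_box r : compact (box r).
Proof.
rewrite (_ : box r = [set v | forall i, `[- r, r]%classic (v 0 i)]).
  by apply: (@rV_compact R d (fun=> `[- r, r]%classic)) => i; exact: segment_compact.
by apply/seteqP; split => x xr i; move: (xr i); rewrite /= in_itv/= ler_norml.
Qed.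

(** The form in which compactness is used, through [compact_near_coveringP]. *)
Lemma near_pairP (T U : Type) (F : set_system T) (G : set_system U)
    (P : T -> U -> Prop) (A : set T) (B : set U) :
  F A -> G B -> (forall t u, A t -> B u -> P t u) ->
  \forall t \near F & u \near G, P t u.
Proof. by move=> FA GB AB; exists (A, B) => // -[t u] [/= ? ?]; exact: AB. Qed.

Lemma compact_sub_box K : compact K -> exists2 r, 0 < r & K `<=` box r.
Proof.
move=> /compact_near_coveringP cK.
have : \forall r \near +oo, K `<=` box r.
  apply: (cK R +oo (fun r x => box r x)) => x Kx.
  apply: near_pairP (near_coord x ltr01)
    (nbhs_pinfty_ge (num_real (\sum_i `|x 0 i| + 1))) _ => y r /= xy rx i.
  rewrite -[y 0 i](subKr (x 0 i)) (le_trans (ler_normB _ _))// (le_trans _ rx)//.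
  rewrite lerD ?(ltW (xy i))// (bigD1 i)//= lerDl; exact: sumr_ge0.
move=> /(filterI (nbhs_pinfty_gt (num_real 0)))/filter_ex[r [r0 Kr]].
by exists r.
Qed.

Lemma compact_bounded_fun K (F : E -> C) : compact K ->
  (forall x, K x -> {for x, continuous F}) ->
  exists2 B : R, 0 < B & forall x, K x -> cabs (F x) <= B.
Proof.
move=> /compact_near_coveringP cK cF.
have : \forall r \near +oo, K `<=` (fun x => cabs (F x) <= r).
  apply: (cK R +oo (fun r x => cabs (F x) <= r)) => x Kx.
  have /cvg_cabsP/(_ 1 ltr01) Fx := cF x Kx.
  apply: near_pairP Fx (nbhs_pinfty_ge (num_real (cabs (F x) + 1))) _.
  move=> y r /= Fxy rx; apply: le_trans rx; rewrite -[F y](subKr (F x)).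
  by rewrite (le_trans (cabsD _ _))// cabsN lerD2l ltW.
move=> /(filterI (nbhs_pinfty_gt (num_real 0)))/filter_ex[r [r0 Kr]].
by exists r.
Qed.

(** Uniform continuity in the form that fits Bernstein's argument: at points that
    are not close, the quadratic term outweighs twice the maximum of |F|. *)
Lemma quadratic_modulus K (F : E -> C) (e : R) : compact K -> 0 < e ->
  continuous F ->
  exists2 B : R, 0 < B & forall x y, K x -> K y ->
    cabs (F x - F y) <= e + B * \sum_i (x 0 i - y 0 i) ^+ 2.
Proof.
move=> cK e0 cF; have [A A0 AP] := compact_bounded_fun cK (fun x _ => cF x).
have : \forall r \near 0^'+, K `<=` (fun x => forall y,
    (forall i, `|x 0 i - y 0 i| < r) -> cabs (F x - F y) <= e).
  move/compact_near_coveringP: cK; apply => x Kx.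
  have e20 : 0 < e / 2 by rewrite divr_gt0.
  have /cvg_cabsP/(_ _ e20) /nearP_coord[r r0 rP] := cF x.
  have r20 : 0 < r / 2 by rewrite divr_gt0.
  apply: near_pairP (near_coord x r20) (nbhs_right_le r20) _.
  move=> x' s /= xx' sr y x'y.
  have h1 : cabs (F x - F x') < e / 2.
    apply: rP => i; apply: lt_le_trans (xx' i) _; lra.
  have h2 : cabs (F x - F y) < e / 2.
    apply: rP => i; rewrite -(subrK (x' 0 i) (x 0 i)) -addrA.
    rewrite (le_lt_trans (ler_normD _ _))//.
    have := xx' i; have := lt_le_trans (x'y i) sr; lra.
  have := cabsD (F x' - F x) (F x - F y).
  by rewrite subrKA [cabs (F x' - F x)]cabsB; lra.
move=> /(filterI (nbhs_right_gt 0))/filter_ex[r [/= r0 rP]].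
(* A bounds F, and r is a distance at which F varies by at most e. *)
exists (2 * A / r ^+ 2) => [|x y Kx Ky]; first by rewrite divr_gt0 ?exprn_gt0// mulr_gt0.
have s0 : 0 <= \sum_i (x 0 i - y 0 i) ^+ 2 by apply: sumr_ge0 => i _; exact: sqr_ge0.
have [xy|] := pselect (forall i, `|x 0 i - y 0 i| < r).
  by rewrite ler_wpDr ?rP// mulr_ge0// divr_ge0 ?sqr_ge0// mulr_ge0// ltW.
move=> /existsNP[i /negP]; rewrite -leNgt => ri.
rewrite ler_wpDl// ?(ltW e0)//; apply: (@le_trans _ _ (2 * A)).
  rewrite (le_trans (cabsD _ _))// cabsN.
  by have := AP x Kx; have := AP y Ky; lra.
rewrite -mulrA ler_peMr ?mulr_ge0 ?(ltW A0)// mulrC ler_pdivlMr ?exprn_gt0// mul1r.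
rewrite (bigD1 i)//= ler_wpDr//; first by apply: sumr_ge0 => j _; exact: sqr_ge0.
by rewrite -(real_normK (num_real (x 0 i - y 0 i))) ler_pXn2r// nnegrE ltW.
Qed.

End Compact.

(** * Bernstein polynomials and the Weierstrass theorem on a box *)

Section Bernstein.
Context {R : realType}.
Implicit Types u : R.

(** The weight C(N, k) u^k (1 - u)^(N - k), by Pascal's recursion. It is the law of
    a sum of N independent Bernoulli variables, so that total mass and variance
    follow by induction on N. *)
Fixpoint bernstein (N k : nat) u : R :=
  if N is N'.+1 then
    u * (if k is k'.+1 then bernstein N' k' u else 0) + (1 - u) * bernstein N' k u
  else (k == 0%N)%:R.

Lemma bernstein_out N k u : (N < k)%N -> bernstein N k u = 0.
Proof.
elim: N k => [[]//|N IH [//|k]]; rewrite ltnS => Nk /=.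
by rewrite !IH ?mulr0 ?addr0// ltnW.
Qed.

Lemma bernstein_ge0 N k u : 0 <= u <= 1 -> 0 <= bernstein N k u.
Proof.
move=> /andP[u0 u1]; elim: N k => [|N IH] k /=; first exact: ler0n.
rewrite addr_ge0 ?mulr_ge0 ?subr_ge0//; by case: k.
Qed.

Lemma bernstein_sum_rec N (f : nat -> R) u :
  \sum_(k < N.+2) bernstein N.+1 k u * f k =
  \sum_(k < N.+1) bernstein N k u * (u * f k.+1 + (1 - u) * f k).
Proof.
under [RHS]eq_bigr do rewrite mulrDr.
rewrite big_split/=; under eq_bigr do rewrite mulrDl.
rewrite big_split/=; congr (_ + _).
  rewrite big_ord_recl/= mulr0 mul0r add0r.
  by apply: eq_bigr => i _; ring.
rewrite big_ord_recr/= bernstein_out// mulr0 mul0r addr0.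
by apply: eq_bigr => i _; ring.
Qed.

Lemma bernstein_sum1 N u : \sum_(k < N.+1) bernstein N k u = 1.
Proof.
elim: N => [|N IH]; first by rewrite big_ord1.
rewrite -[RHS]IH; under eq_bigr do rewrite -[bernstein _ _ _]mulr1.
by rewrite (bernstein_sum_rec N (fun=> 1)); apply: eq_bigr => i _; ring.
Qed.

Lemma bernstein_variance N u :
  \sum_(k < N.+1) bernstein N k u * (k%:R - N%:R * u) ^+ 2 = N%:R * (u * (1 - u)).
Proof.
elim: N => [|N IH]; first by rewrite big_ord1/= !mul0r subr0 expr0n mulr0.
rewrite (bernstein_sum_rec N (fun k => (k%:R - N.+1%:R * u) ^+ 2)).
have -> : N.+1%:R * (u * (1 - u)) =
    N%:R * (u * (1 - u)) + (\sum_(k < N.+1) bernstein N k u) * (u * (1 - u)).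
  by rewrite bernstein_sum1 -natr1; ring.
rewrite -IH.
rewrite mulr_suml -big_split/=; apply: eq_bigr => i _.
by rewrite -natr1; ring.
Qed.

End Bernstein.

Section PolynomialFunctions.
Context {R : realType} {d : nat}.
Local Notation E := 'rV[R]_d.
Local Notation C := (R[i]^o).

(** The algebra generated by the coordinates, free of any choice of origin. *)
Inductive polyfun : (E -> C) -> Prop :=
| polyfun_cst (c : C) : polyfun (fun=> c)
| polyfun_coord i : polyfun (fun x => real_complex R (x 0 i))
| polyfunD f g : polyfun f -> polyfun g -> polyfun (fun x => f x + g x)
| polyfunM f g : polyfun f -> polyfun g -> polyfun (fun x => f x * g x : R[i]).

Lemma polyfun_sum (I : Type) (r : seq I) (F : I -> E -> C) :
  (forall i, polyfun (F i)) -> polyfun (fun x => \sum_(i <- r) F i x).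
Proof.
move=> pF; elim: r => [|i r IH].
  by under eq_fun do rewrite big_nil; exact: polyfun_cst.
by under eq_fun do rewrite big_cons; exact: polyfunD.
Qed.

Lemma polyfun_prod (I : Type) (r : seq I) (F : I -> E -> C) :
  (forall i, polyfun (F i)) -> polyfun (fun x => \prod_(i <- r) (F i x : R[i])).
Proof.
move=> pF; elim: r => [|i r IH].
  by under eq_fun do rewrite big_nil; exact: polyfun_cst.
by under eq_fun do rewrite big_cons; exact: polyfunM.
Qed.

Lemma polyfun_bernstein N k (a b : R) i :
  polyfun (fun x => real_complex R (bernstein N k (a * x 0 i + b))).
Proof.
have paff (c e : R) : polyfun (fun x => real_complex R (c * x 0 i + e)).
  under eq_fun do rewrite rmorphD rmorphM.
  exact: (polyfunD (polyfunM (polyfun_cst _) (polyfun_coord i)) (polyfun_cst _)).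
elim: N k => [|N IH] k /=; first exact: polyfun_cst.
under eq_fun do rewrite rmorphD !rmorphM.
apply: polyfunD; apply: polyfunM => //.
- exact: paff.
- by case: k => [|k]; [exact: polyfun_cst|exact: IH].
- have -> : (fun x : E => real_complex R (1 - (a * x 0 i + b))) =
     (fun x : E => real_complex R (- a * x 0 i + (1 - b))).
    by apply/funext => x; congr (real_complex R _); ring.
  exact: paff.
- exact: IH.
Qed.

(** The sum of F at the nodes against the product weights is a mean of the values
    of F. By [quadratic_modulus] its error is at most e / 2 plus a multiple of the
    sum of the variances in the d directions, which is of order 1 / N. *)
Theorem weierstrass (F : E -> C) (a e : R) : continuous F -> 0 < a -> 0 < e ->
  exists2 q, polyfun q & forall x, box a x -> cabs (F x - q x) <= e.
Proof.
move=> cF a0 e0; have e20 : 0 < e / 2 by rewrite divr_gt0.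
have [B B0 BP] := quadratic_modulus (@compact_box R d a) e20 cF.
have [N /= N0 NP] : exists2 N : nat, (0 < N)%N & B * (d%:R * (2 * a) ^+ 2) / N%:R <= e / 2.
  set c := B * _.
  have c0 : 0 <= c by rewrite mulr_ge0 ?mulr_ge0 ?sqr_ge0// ltW.
  exists (Num.truncn (c / (e / 2))).+1 => //.
  rewrite ler_pdivrMr ?ltr0n// -ler_pdivrMl// mulrC ltW//.
  exact: truncnS_gt.
pose u (t : R) := (2 * a)^-1 * t + 2^-1.
pose node (k : {ffun 'I_d -> 'I_N.+1}) : E :=
  \row_i (2 * a * ((k i)%:R / N%:R) - a).
pose w (k : {ffun 'I_d -> 'I_N.+1}) (x : E) : R := \prod_i bernstein N (k i) (u (x 0 i)).
have Nn0 : N%:R != 0 :> R by rewrite pnatr_eq0 -lt0n.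
(* u maps [-a, a] onto [0, 1], and node k is the point with u-coordinates k / N. *)
exists (fun x => \sum_k F (node k) * real_complex R (w k x) : R[i]).
  apply: polyfun_sum => k; apply: polyfunM; first exact: polyfun_cst.
  rewrite /w; under eq_fun do rewrite rmorph_prod.
  by apply: polyfun_prod => i; exact: polyfun_bernstein.
move=> x xa.
have u01 i : 0 <= u (x 0 i) <= 1.
  have := xa i; rewrite ler_norml /u => /andP[x1 x2].
  rewrite -(ler_pM2l (_ : 0 < 2 * a)) ?mulr_gt0// mulr0.
  rewrite -(ler_pM2l (_ : 0 < 2 * a) (_ + _)) ?mulr_gt0// mulr1 mulrDr.
  by rewrite mulVKf ?gt_eqF ?mulr_gt0//; apply/andP; split; lra.
have w0 k : 0 <= w k x by apply: prodr_ge0 => i _; exact: bernstein_ge0.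
have w1 : \sum_k w k x = 1.
  rewrite -(bigA_distr_bigA (fun i (k : 'I_N.+1) => bernstein N k (u (x 0 i)))).
  by rewrite big1// => i _; exact: bernstein_sum1.
have wV i : \sum_k w k x * (x 0 i - node k 0 i) ^+ 2 <= (2 * a) ^+ 2 / N%:R.
  (* Only the i-th factor of the product weight carries a square. *)
  pose c j (m : 'I_N.+1) : R :=
    if j == i then (x 0 i - (2 * a * (m%:R / N%:R) - a)) ^+ 2 else 1.
  have -> : \sum_k w k x * (x 0 i - node k 0 i) ^+ 2 =
     \sum_(k : {ffun 'I_d -> 'I_N.+1}) \prod_j (bernstein N (k j) (u (x 0 j)) * c j (k j)).
    apply: eq_bigr => k _; rewrite big_split/= -/(w k x); congr (_ * _).
    rewrite (bigD1 i)//= /c eqxx big1 ?mulr1 ?mxE// => j /negPf ->; by [].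
  rewrite -(bigA_distr_bigA (fun j (m : 'I_N.+1) => bernstein N m (u (x 0 j)) * c j m)).
  rewrite (bigD1 i)//= [X in _ * X]big1 ?mulr1; last first.
    move=> j /negPf ji; rewrite -[RHS](bernstein_sum1 N (u (x 0 j))).
    by apply: eq_bigr => m _; rewrite /c ji mulr1.
  have -> : \sum_(m < N.+1) bernstein N m (u (x 0 i)) * c i m =
    (2 * a / N%:R) ^+ 2 * (N%:R * (u (x 0 i) * (1 - u (x 0 i)))).
    rewrite -bernstein_variance mulr_sumr; apply: eq_bigr => m _.
    rewrite /c eqxx /u; field; by rewrite Nn0 gt_eqF.
  have -> : (2 * a / N%:R) ^+ 2 * (N%:R * (u (x 0 i) * (1 - u (x 0 i)))) =
    (2 * a) ^+ 2 / N%:R * (u (x 0 i) * (1 - u (x 0 i))).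
    by field.
  rewrite ler_piMr ?divr_ge0 ?sqr_ge0//.
  by have /andP[? ?] := u01 i; rewrite mulr_ile1 ?subr_ge0// gerBl.
have -> : F x - \sum_k F (node k) * real_complex R (w k x) =
  \sum_k (F x - F (node k)) * real_complex R (w k x).
  under [RHS]eq_bigr do rewrite mulrBl.
  by rewrite sumrB -mulr_sumr -rmorph_sum/= w1 mulr1.
rewrite (le_trans (cabs_sum _ _ _))//.
have nodeK k : box a (node k).
  move=> i; rewrite mxE ler_norml; have : (k i)%:R / N%:R <= 1 :> R.
    by rewrite ler_pdivrMr ?ltr0n// mul1r ler_nat -ltnS.
  have : 0 <= (k i)%:R / N%:R :> R by rewrite divr_ge0.
  by set s := _ / _ => s0 s1; apply/andP; split; nra.
apply: (@le_trans _ _ (\sum_k (e / 2 + B * \sum_i (x 0 i - node k 0 i) ^+ 2) * w k x)).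
  apply: ler_sum => k _; rewrite cabsM cabs_real ger0_norm// ler_wpM2r//.
  exact: BP.
under eq_bigr do rewrite mulrDl.
rewrite big_split/= -mulr_sumr w1 mulr1.
suff : \sum_k B * (\sum_i (x 0 i - node k 0 i) ^+ 2) * w k x <= e / 2 by lra.
apply: le_trans NP; rewrite -mulrA.
under eq_bigr do rewrite -mulrA; rewrite -mulr_sumr ler_wpM2l ?(ltW B0)//.
under eq_bigr do rewrite mulr_suml; rewrite exchange_big/=.
apply: (@le_trans _ _ (\sum_(i < d) (2 * a) ^+ 2 / N%:R)).
  by apply: ler_sum => i _; apply: le_trans (wV i); under eq_bigr do rewrite mulrC.
by rewrite sumr_const card_ord -[leLHS]mulr_natl [leLHS]mulrA lexx.
Qed.

End PolynomialFunctions.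

(** * The Leibniz rule and cut-off functions *)

Section SmoothCalculus.
Context {R : realType} {d : nat}.
Local Notation E := 'rV[R]_d.
Local Notation C := (R[i]^o).
Implicit Types (f g : E -> C) (x y : E) (i : 'I_d) (A : set E) (s : seq 'I_d).

Lemma is_pderivM i f g x (k l : C) :
  is_pderiv i f x k -> is_pderiv i g x l ->
  is_pderiv i (fun y => f y * g y : R[i]) x (k * g x + f x * l : R[i]).
Proof.
move=> [f1 f2] [g1 g2].
have ReM (z w : R[i]) : complex.Re (z * w) =
  complex.Re z * complex.Re w - complex.Im z * complex.Im w by case: z w => ? ? [].
have ImM (z w : R[i]) : complex.Im (z * w) =
  complex.Re z * complex.Im w + complex.Im z * complex.Re w by case: z w => ? ? [].
have ReD (z w : R[i]) : complex.Re (z + w) = complex.Re z + complex.Re w by case: z w => ? ? [].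
have ImD (z w : R[i]) : complex.Im (z + w) = complex.Im z + complex.Im w by case: z w => ? ? [].
split.
  under eq_fun do rewrite ReM.
  apply: (is_derive_eq (is_deriveB (is_deriveM f1 g1) (is_deriveM f2 g2))).
  by rewrite ReD !ReM /GRing.scale/=; ring.
under eq_fun do rewrite ImM.
apply: (is_derive_eq (is_deriveD (is_deriveM f1 g2) (is_deriveM f2 g1))).
by rewrite ImD !ImM /GRing.scale/=; ring.
Qed.

Lemma is_pderivD i f g x (k l : C) :
  is_pderiv i f x k -> is_pderiv i g x l ->
  is_pderiv i (fun y => f y + g y) x (k + l).
Proof.
move=> df dg; have := is_pderiv_lin 1 df dg.
by rewrite !scale1r.
Qed.

Lemma is_pderiv_cst i (c : C) x : is_pderiv i (fun=> c) x 0.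
Proof. by split; exact: is_derive_cst. Qed.

Lemma is_pderiv_sum (I : Type) (r : seq I) (F G : I -> E -> C) i x :
  (forall j, is_pderiv i (F j) x (G j x)) ->
  is_pderiv i (fun y => \sum_(j <- r) F j y) x (\sum_(j <- r) G j x).
Proof.
move=> dF; elim: r => [|j r IH].
  by rewrite big_nil; under eq_fun do rewrite big_nil; exact: is_pderiv_cst.
by rewrite big_cons; under eq_fun do rewrite big_cons; exact: is_pderivD.
Qed.

Lemma pderivs_lin A f g (a : R[i]) s x : open A ->
  smooth_on A f -> smooth_on A g -> A x ->
  pderivs s (a *: f + g) x = a *: pderivs s f x + pderivs s g x.
Proof.
move=> oA sf sg Ax.
have [//| | |_ ->//] := @smooth_onP _ _ A (a *: f + g)
  (fun s => a *: pderivs s f + pderivs s g) oA.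
- move=> t y Ay; apply: (@cvgD _ _ _ (nbhs y)); last exact: (sg t y Ay).1.
  by apply: (@cvgZl_tmp _ _ _ (nbhs y)); exact: (sf t y Ay).1.
- move=> t i y Ay.
  exact: is_pderiv_lin (smooth_on_pderiv sf t i Ay) (smooth_on_pderiv sg t i Ay).
Qed.

(** Each letter of the word s acts on one of the two factors. *)
Fixpoint leibniz s : seq (seq 'I_d * seq 'I_d) :=
  if s is i :: s' then
    [seq (i :: ab.1, ab.2) | ab <- leibniz s'] ++
    [seq (ab.1, i :: ab.2) | ab <- leibniz s']
  else [:: ([::], [::])].

Lemma leibniz_size s ab : ab \in leibniz s -> (size ab.1 + size ab.2)%N = size s.
Proof.
elim: s ab => [|i s IH] ab /=; first by rewrite inE => /eqP->.
by rewrite mem_cat => /orP[] /mapP[cd /IH <- ->]//=; rewrite addnS.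
Qed.

Lemma smooth_on_mulP A f g : open A -> smooth_on A f -> smooth_on A g ->
  smooth_on A (fun y => f y * g y : R[i]) /\
  (forall s x, A x -> pderivs s (fun y => f y * g y : R[i]) x =
     \sum_(ab <- leibniz s) (pderivs ab.1 f x * pderivs ab.2 g x : R[i])).
Proof.
move=> oA sf sg; apply: smooth_onP => //.
- by move=> x _; rewrite /leibniz/= big_seq1.
- move=> s x Ax; rewrite /prop_for/continuous_at.
  elim: (leibniz s) => [|ab r IH].
    by under eq_fun do rewrite big_nil; rewrite big_nil; exact: (@cvg_cst _ _ _ (nbhs x)).
  rewrite big_cons; under eq_fun do rewrite big_cons.
  apply: (@cvgD _ _ _ (nbhs x)); last exact: IH.
  apply: (@cvgM R[i] _ (nbhs x)); first exact: (sf _ x Ax).1.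
  exact: (sg _ x Ax).1.
- move=> s i x Ax; rewrite /= big_cat !big_map/= -big_split/=.
  apply: (@is_pderiv_sum _ _ _
    (fun ab y => pderivs (i :: ab.1) f y * pderivs ab.2 g y +
       pderivs ab.1 f y * pderivs (i :: ab.2) g y : R[i])) => ab.
  exact: is_pderivM (smooth_on_pderiv sf ab.1 i Ax) (smooth_on_pderiv sg ab.2 i Ax).
Qed.

Lemma smooth_on_cst A (c : C) : smooth_on A (fun=> c).
Proof.
apply: (@smooth_on_coind _ _ A [set g | exists c : C, g = fun=> c]); last by exists c.
  by move=> _ [e ->] x; exact: (@cvg_cst _ _ _ (nbhs x)).
by move=> _ i [e ->]; exists (fun=> 0); [exists 0|move=> x; split; exact: is_derive_cst].
Qed.

Lemma is_derive_prod (g g' : 'I_d -> R -> R) i x :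
  is_derive (x 0 i) 1 (g i) (g' i (x 0 i)) ->
  is_derive x (delta_mx 0 i : E) (fun y : E => \prod_j g j (y 0 j) : R)
    (\prod_j (if j == i then g' j else g j) (x 0 j)).
Proof.
move=> dg; apply/is_derive_line.
pose P : R := \prod_(j | j != i) g j (x 0 j).
have -> : (fun h : R => \prod_j g j ((h *: delta_mx 0 i + x) 0 j) : R) =
    P \*: (g i \o (id + cst (x 0 i) : R -> R)).
  apply/funext => h; rewrite /= (bigD1 i)//= !mxE !eqxx mulr1 [RHS]mulrC.
  congr (_ * _); apply: eq_bigr => j /negPf ji.
  by rewrite !mxE ji mulr0 add0r.
have d1 : is_derive (0 : R) 1 (id + cst (x 0 i) : R -> R) (1 + 0).
  exact: is_deriveD.
have dg' : is_derive ((id + cst (x 0 i) : R -> R) 0) 1 (g i) (g' i (x 0 i)).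
  by rewrite !fctE add0r.
apply: (is_derive_eq (is_deriveZ P (is_derive1_comp dg' d1))).
rewrite (bigD1 i)//= eqxx addr0 /GRing.scale/= mulr1 mulrC; congr (_ * _).
by apply: eq_bigr => j /negPf ->.
Qed.

(** The j-th factor is differentiated as often as j occurs in s. *)
Lemma smooth_on_prodP (D : 'I_d -> nat -> R -> R) :
  (forall j n (t : R), is_derive t 1 (D j n) (D j n.+1 t)) ->
  smooth_on setT (fun y => real_complex R (\prod_j D j 0%N (y 0 j))) /\
  (forall s x, setT x ->
     pderivs s (fun y => real_complex R (\prod_j D j 0%N (y 0 j))) x =
     real_complex R (\prod_j D j (count_mem j s) (x 0 j))).
Proof.
move=> DD; apply: (@smooth_onP _ _ setT _
  (fun s x => real_complex R (\prod_j D j (count_mem j s) (x 0 j)))) => //.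
- exact: openT.
- move=> s x _; apply: (@continuous_comp _ _ _
    (fun y : E => \prod_j D j (count_mem j s) (y 0 j) : R)
    (real_complex R : R -> C)); last exact: real_complex_continuous.
  rewrite /prop_for/continuous_at; elim: (index_enum _) => [|i r IH].
    by rewrite big_nil; under eq_fun do rewrite big_nil; exact: (@cvg_cst _ _ _ (nbhs x)).
  rewrite big_cons; under eq_fun do rewrite big_cons.
  apply: (@cvgM _ _ (nbhs x)); last exact: IH.
  apply: (@continuous_comp _ _ _ (fun y : E => y 0 i) (D i (count_mem i s))).
    exact: coord_continuous.
  exact/differentiable_continuous/derivable1_diffP.
- move=> s i x _; split => /=; last exact: is_derive_cst.
  apply: (is_derive_eq (@is_derive_prod (fun j => D j (count_mem j s))
    (fun j => D j (count_mem j s).+1) i x (DD _ _ _))).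
  by apply: eq_bigr => j _; rewrite eq_sym; case: eqVneq.
Qed.

Lemma smooth_on_prod (g : 'I_d -> R -> R) : (forall i, smooth1 (g i)) ->
  smooth_on setT (fun y => real_complex R (\prod_j g j (y 0 j))).
Proof.
move=> sg; have /choice[D DP] j : exists D : nat -> R -> R, D 0%N = g j /\
    forall n (t : R), is_derive t 1 (D n) (D n.+1 t).
  by have [D ? ?] := sg j; exists D.
have [+ _] := smooth_on_prodP (fun j => (DP j).2).
congr smooth_on; apply/funext => y; congr (real_complex R _).
by apply: eq_bigr => j _; rewrite (DP j).1.
Qed.

Definition supp f : set E := closure [set x | f x != 0].

Lemma suppP f x : ~ supp f x -> f x = 0.
Proof.
by move=> sx; apply/eqP/negPn/negP => fx; apply: sx; exact: subset_closure.
Qed.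

Lemma closed_supp f : closed (supp f).
Proof. exact: closed_closure. Qed.

Lemma supp_sub f (K : set E) : closed K -> (forall x, ~ K x -> f x = 0) ->
  supp f `<=` K.
Proof.
move=> cK fK; rewrite (closure_id K).1//.
apply: closureS => x /= fx; apply: contrapT => /fK f0.
by rewrite f0 eqxx in fx.
Qed.

Lemma pderivs_out f s x : ~ supp f x -> pderivs s f x = 0.
Proof.
move=> sx; have oA : open (~` supp f) by apply: closed_openC; exact: closed_supp.
have f0 : {in ~` supp f, (fun=> 0) =1 f} by move=> y /set_mem ys; rewrite suppP.
have [_ ->//] := smooth_on_eq oA (@smooth_on_cst _ 0) f0.
have [//| | |_ h] := @smooth_onP R d setT (fun=> 0) (fun=> (fun=> 0)) openT; last exact: h.
- by move=> t y _; exact: (@cvg_cst _ _ _ (nbhs y)).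
- by move=> t i y _; exact: is_pderiv_cst.
Qed.

(** A product of one-dimensional plateaus, one for each coordinate. *)
Lemma bump_exists x (U : set E) : open U -> U x ->
  exists b : E -> C, [/\ smooth_on setT b, compact (supp b), supp b `<=` U &
    exists2 V : set E, open_nbhs x V & forall y, V y -> b y = 1].
Proof.
move=> oU Ux; have [e e0 eU] : exists2 e : R, 0 < e &
    forall y, (forall i, `|x 0 i - y 0 i| < e) -> U y.
  by apply: nearP_coord; apply: open_nbhs_nbhs; split.
have [g sg [g1 g2]] := @plateau_exists R.
pose r := e / 3; have r0 : 0 < r by rewrite divr_gt0.
pose Q := [set y : E | forall i, `[x 0 i - 2 * r, x 0 i + 2 * r]%classic (y 0 i)].
have cQ : compact Q.
  apply: (@rV_compact R d (fun i => `[x 0 i - 2 * r, x 0 i + 2 * r]%classic)) => i.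
  exact: segment_compact.
have clQ : closed Q by apply: compact_closed => //; exact: norm_hausdorff.
pose b := fun y : E => real_complex R (\prod_j g (r^-1 * y 0 j + - (r^-1 * x 0 j))).
have gE (y : E) j : `|r^-1 * y 0 j - r^-1 * x 0 j| = r^-1 * `|x 0 j - y 0 j|.
  by rewrite -mulrBr normrM gtr0_norm ?invr_gt0// distrC.
have bQ : supp b `<=` Q.
  apply: supp_sub => // y /existsNP[i yi]; rewrite /b (bigD1 i)//= g2 ?mul0r//.
  rewrite gE mulrC ler_pdivlMr//; move: yi; rewrite /= in_itv/= => /negP.
  rewrite negb_and -!ltNge => yi; rewrite ltW//.
  by rewrite lter_normr; apply/orP; case/orP: yi => ?; [left|right]; lra.
exists b; split.
- apply: (@smooth_on_prod (fun j t => g (r^-1 * t + - (r^-1 * x 0 j)))) => i.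
  exact: smooth1_comp_affine.
- exact: (subclosed_compact (@closed_supp b) cQ bQ).
- move=> y /bQ yQ; apply: eU => i; have := yQ i.
  rewrite /= in_itv/= => /andP[y1 y2].
  have re : e = 3 * r by rewrite /r; field.
  by rewrite ltr_norml; apply/andP; split; lra.
- have /(@near_coord R d x) := r0.
  rewrite -[X in X -> _]/(nbhs x _) nbhsE => -[V oV VP].
  exists V => // y /VP yP; rewrite /b big1//= => j _; apply: g1.
  by rewrite gE mulrC ler_pdivrMr// mul1r ltW.
Qed.

(** Since 1 - (a + b - a b) = (1 - a) (1 - b), the class B is stable under the
    operation that joins the sets where a = 1 and b = 1; a finite subcover of K
    then gives one function equal to 1 around K. The choice of B serves both for
    cut-off functions and for the functions that a distribution ignores. *)
Lemma plateau_on_compact (B : set (E -> C)) (K : set E) : compact K ->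
  B (fun=> 0) ->
  (forall a b, B a -> B b -> B (fun y => a y + b y - (a y * b y : R[i]))) ->
  (forall x, K x -> exists2 b, B b &
     exists2 V : set E, open_nbhs x V & forall y, V y -> b y = 1) ->
  exists2 a, B a & exists2 V : set E, open V /\ K `<=` V & forall y, V y -> a y = 1.
Proof.
move=> cK B0 BM BK.
have /choice[b bP] x : exists bV : (E -> C) * set E, K x ->
    [/\ B bV.1, open_nbhs x bV.2 & forall y, bV.2 y -> bV.1 y = 1].
  have [/BK[b Bb [V xV b1]]|Kx] := pselect (K x); first by exists (b, V).
  by exists (fun=> 0, set0).
have [D DK KD] : exists2 D : {fset E}, {subset D <= K} &
    K `<=` cover [set` D] (fun x => (b x).2).
  move: cK; rewrite compact_cover => /(_ E K (fun x => (b x).2)); apply.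
    by move=> x /bP[_ []].
  by move=> x Kx; exists x => //; have [_ [_ ?] _] := bP x Kx.
have [a Ba a1] : exists2 a, B a & forall x y, x \in (D : seq E) -> (b x).2 y -> a y = 1.
  have : forall x, x \in (D : seq E) -> K x by move=> x /DK/set_mem.
  elim: (D : seq E) => [_|x l IH lK]; first by exists (fun=> 0).
  have [|a Ba aP] := IH; first by move=> y yl; apply: lK; rewrite inE yl orbT.
  have [Bx [oV _] bx1] := bP x (lK x (mem_head _ _)).
  exists (fun y => (b x).1 y + a y - ((b x).1 y * a y : R[i])); first exact: BM.
  move=> z y; rewrite inE => /orP[/eqP->|zl] yz.
    by rewrite bx1// mul1r addrK.
  by rewrite (aP z y)// mulr1 addrAC subrr add0r.
exists a => //; exists (cover [set` D] (fun x => (b x).2)).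
  split => //; apply: bigcup_open => x /= xD.
  by have [_ []] := bP x (set_mem (DK x xD)).
by move=> y [x /= xD xy]; exact: a1 xD xy.
Qed.

Lemma smooth_on_comb A f g : open A -> smooth_on A f -> smooth_on A g ->
  smooth_on A (fun y => f y + g y - (f y * g y : R[i])).
Proof.
move=> oA sf sg; have [sfg _] := smooth_on_mulP oA sf sg.
have := smooth_on_lin (-1) oA sfg (smooth_on_lin 1 oA sf sg).
congr smooth_on; apply/funext => y.
by rewrite !fctE/= scaleN1r scale1r addrC.
Qed.

Lemma cutoff_exists (K U : set E) : compact K -> open U -> K `<=` U ->
  exists a : E -> C, [/\ smooth_on setT a, compact (supp a), supp a `<=` U &
    exists2 V : set E, open V /\ K `<=` V & forall y, V y -> a y = 1].
Proof.
move=> cK oU KU.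
pose B : set (E -> C) := [set a : E -> C | [/\ smooth_on setT a,
  compact (supp a) & supp a `<=` U]].
have [||x Kx|a [? ? ?] aV] := @plateau_on_compact B K cK; last by exists a; split.
- split; first exact: smooth_on_cst.
    rewrite (_ : supp _ = set0); first exact: compact0.
    by rewrite -subset0; apply: supp_sub => //; exact: closed0.
  by apply: subset_trans (sub0set U); apply: supp_sub => //; exact: closed0.
- move=> a b [sa ca aU] [sb cb bU].
  have h : supp (fun y => a y + b y - (a y * b y : R[i])) `<=` supp a `|` supp b.
    apply: supp_sub; first by apply: closedU; exact: closed_supp.
    by move=> x /not_orP[/suppP-> /suppP->]; rewrite mul0r subr0 addr0.
  split; first by apply: smooth_on_comb => //; exact: openT.
    by apply: subclosed_compact h; [exact: closed_supp|exact: compactU].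
  by apply: subset_trans h _ => x [/aU|/bU].
- have [b [sb cb bU bV]] := bump_exists oU (KU _ Kx).
  by exists b.
Qed.

End SmoothCalculus.

(** * Symmetry of the mixed partial derivatives *)

Section Schwarz.
Context {R : realType} {d : nat}.
Local Notation E := 'rV[R]_d.
Local Notation C := (R[i]^o).
Implicit Types (f g : E -> C) (x y v : E) (i : 'I_d) (s : seq 'I_d).

Lemma is_derive_along (g g' : E -> R) v x (t : R) :
  (forall y, is_derive y v g (g' y)) ->
  is_derive t 1 (fun h : R => g (h *: v + x)) (g' (t *: v + x)).
Proof.
move=> dg; pose k (h : R) := g (h *: v + (t *: v + x)).
have -> : (fun h : R => g (h *: v + x)) = k \o (id + cst (- t)).
  by apply/funext => h; rewrite /k /= !fctE addrA -scalerDl subrK.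
have di : is_derive t 1 (id + cst (- t) : R -> R) (1 + 0) by exact: is_deriveD.
have dk : is_derive ((id + cst (- t) : R -> R) t) 1 k (g' (t *: v + x)).
  by rewrite !fctE subrr; apply/is_derive_line.
by apply: (is_derive_eq (is_derive1_comp dk di)); rewrite addr0 mulr1.
Qed.

Lemma mvt_along (g g' : E -> R) v x (h : R) : 0 < h ->
  (forall y, is_derive y v g (g' y)) ->
  exists2 t, t \in `]0, h[%R & g (h *: v + x) - g x = h * g' (t *: v + x).
Proof.
move=> h0 dg; have dl := is_derive_along x ^~ dg.
have [t|t t0h] := @MVT R (fun s : R => g (s *: v + x)) (fun t : R => g' (t *: v + x)) 0 h h0
  (fun t _ => dl t).
  apply: continuous_subspaceT => s.
  exact/differentiable_continuous/derivable1_diffP.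
by rewrite scale0r add0r subr0 => ->; exists t => //; rewrite mulrC.
Qed.

(** The mean value theorem in direction v for y |-> u (y + h w) - u y, then in
    direction w for its derivative. *)
Lemma second_difference (u ui uij : E -> R) v w x (h : R) : 0 < h ->
  (forall y, is_derive y v u (ui y)) -> (forall y, is_derive y w ui (uij y)) ->
  exists s t : R, [/\ s \in `]0, h[%R, t \in `]0, h[%R &
    u (h *: v + (h *: w + x)) - u (h *: v + x) - (u (h *: w + x) - u x) =
    h * (h * uij (t *: w + (s *: v + x)))].
Proof.
move=> h0 du dui.
pose g y := u (h *: w + y) - u y.
have dg y : is_derive y v g (ui (h *: w + y) - ui y).
  apply: (is_deriveB _ (du y)); apply/is_derive_line.
  have /is_derive_line := du (h *: w + y).
  by under [X in is_derive _ _ X]eq_fun do rewrite addrCA.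
have [s s0 gs] := mvt_along x h0 dg.
have [t t0 ut] := mvt_along (s *: v + x) h0 dui.
exists s, t; split => //.
by rewrite -ut -gs /g addrCA; ring.
Qed.

(** The second difference is symmetric in i and j, so the two mixed derivatives
    take a common value at points as close to x as desired. *)
Lemma schwarz_real (u ui uj uij uji : E -> R) i j x :
  (forall y, is_derive y (delta_mx 0 i : E) u (ui y)) ->
  (forall y, is_derive y (delta_mx 0 j : E) u (uj y)) ->
  (forall y, is_derive y (delta_mx 0 j : E) ui (uij y)) ->
  (forall y, is_derive y (delta_mx 0 i : E) uj (uji y)) ->
  {for x, continuous uij} -> {for x, continuous uji} -> uij x = uji x.
Proof.
move=> dui duj duij duji cij cji; apply/eqP; rewrite -subr_eq0 -normr_le0.
apply/ler_addgt0Pl => e e0; rewrite addr0.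
have e20 : 0 < e / 2 by rewrite divr_gt0.
have /cvgrPdist_lt/(_ _ e20)/nearP_coord[r1 r10 r1P] := cij.
have /cvgrPdist_lt/(_ _ e20)/nearP_coord[r2 r20 r2P] := cji.
pose r := Num.min r1 r2; have r0 : 0 < r by rewrite lt_min r10.
pose h := r / 2; have h0 : 0 < h by rewrite divr_gt0.
have close (s t : R) k l m : s \in `]0, h[%R -> t \in `]0, h[%R ->
    `|x 0 m - (t *: delta_mx 0 k + (s *: delta_mx 0 l + x) : E) 0 m| < r.
  rewrite !in_itv/= => /andP[s0 sh] /andP[t0 th]; rewrite !mxE /=.
  have sub3 (p q z : R) : z - (p + (q + z)) = - (p + q) by ring.
  rewrite sub3 normrN.
  apply: (@le_lt_trans _ _ (t + s)); last by rewrite /h in sh th; lra.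
  apply: le_trans (ler_normD _ _) _.
  by rewrite lerD// normrM gtr0_norm// ler_piMr ?(ltW t0) ?(ltW s0)//;
    case: eqP; rewrite ?normr1 ?normr0.
have [s [t [s0 t0 st]]] := second_difference x h0 dui duij.
have [s' [t' [s'0 t'0 st']]] := second_difference x h0 duj duji.
have hh : uij (t *: delta_mx 0 j + (s *: delta_mx 0 i + x)) =
          uji (t' *: delta_mx 0 i + (s' *: delta_mx 0 j + x)).
  apply: (mulfI (lt0r_neq0 h0)); apply: (mulfI (lt0r_neq0 h0)).
  by rewrite -st -st' addrCA; ring.
have h1 : `|uij x - uij (t *: delta_mx 0 j + (s *: delta_mx 0 i + x))| < e / 2.
  by apply: r1P => m; apply: lt_le_trans (close _ _ _ _ _ s0 t0) _; rewrite ge_min lexx.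
have h2 : `|uji x - uji (t' *: delta_mx 0 i + (s' *: delta_mx 0 j + x))| < e / 2.
  by apply: r2P => m; apply: lt_le_trans (close _ _ _ _ _ s'0 t'0) _; rewrite ge_min lexx orbT.
rewrite -[uij x](subrK (uij (t *: delta_mx 0 j + (s *: delta_mx 0 i + x)))) -addrA.
rewrite [X in _ + (X - _)]hh (le_trans (ler_normD _ _))// [X in _ + X]distrC; lra.
Qed.

Lemma pderivs_swap f i j : smooth_on setT f ->
  pderivs [:: i; j] f = pderivs [:: j; i] f.
Proof.
move=> sf; apply/funext => x.
have dd s k y : is_pderiv k (pderivs s f) y (pderivs (k :: s) f y).
  exact: smooth_on_pderiv sf s k y I.
have cRe g : {for x, continuous g} -> {for x, continuous (fun y => complex.Re (g y) : R)}.
  move=> /continuous_cabsP cg; rewrite /prop_for/continuous_at.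
  apply/(@cvgrPdist_lt _ _ _ (nbhs x)) => e e0; apply: filterS (cg e e0) => y.
  apply: le_lt_trans; apply: le_trans (Re_le_cabs _).
  by case: (g x) (g y) => ? ? [].
have cIm g : {for x, continuous g} -> {for x, continuous (fun y => complex.Im (g y) : R)}.
  move=> /continuous_cabsP cg; rewrite /prop_for/continuous_at.
  apply/(@cvgrPdist_lt _ _ _ (nbhs x)) => e e0; apply: filterS (cg e e0) => y.
  apply: le_lt_trans; apply: le_trans (Im_le_cabs _).
  by case: (g x) (g y) => ? ? [].
apply/eqP; rewrite eq_complex; apply/andP; split; apply/eqP.
  apply: (@schwarz_real (fun y => complex.Re (f y)) (fun y => complex.Re (pderivs [:: j] f y))
    (fun y => complex.Re (pderivs [:: i] f y))
    (fun y => complex.Re (pderivs [:: i; j] f y))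
    (fun y => complex.Re (pderivs [:: j; i] f y)) j i x).
  - by move=> y; exact: (dd [::] j y).1.
  - by move=> y; exact: (dd [::] i y).1.
  - by move=> y; exact: (dd [:: j] i y).1.
  - by move=> y; exact: (dd [:: i] j y).1.
  - by apply: cRe; exact: (sf [:: i; j] x I).1.
  - by apply: cRe; exact: (sf [:: j; i] x I).1.
apply: (@schwarz_real (fun y => complex.Im (f y)) (fun y => complex.Im (pderivs [:: j] f y))
    (fun y => complex.Im (pderivs [:: i] f y))
    (fun y => complex.Im (pderivs [:: i; j] f y))
    (fun y => complex.Im (pderivs [:: j; i] f y)) j i x).
- by move=> y; exact: (dd [::] j y).2.
- by move=> y; exact: (dd [::] i y).2.
- by move=> y; exact: (dd [:: j] i y).2.
- by move=> y; exact: (dd [:: i] j y).2.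
- by apply: cIm; exact: (sf [:: i; j] x I).1.
- by apply: cIm; exact: (sf [:: j; i] x I).1.
Qed.

Lemma pderivs_cat s t f : pderivs (s ++ t) f = pderivs s (pderivs t f).
Proof. by rewrite /pderivs foldr_cat. Qed.

Lemma smooth_on_pderivs A s f : smooth_on A f -> smooth_on A (pderivs s f).
Proof. by move=> sf t x Ax; have := sf (t ++ s) x Ax; rewrite pderivs_cat. Qed.

Lemma pderivs_perm s t f : smooth_on setT f -> perm_eq s t ->
  pderivs s f = pderivs t f.
Proof.
move=> sf; elim: s t => [|i s IH] t; first by rewrite perm_sym => /perm_nilP->.
move=> pt; have it : i \in t by rewrite -(perm_mem pt) mem_head.
case/splitPr: it pt => t1 t2.
rewrite perm_sym -[i :: t2]cat1s perm_catCA perm_cons perm_sym => /IH /= ->.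
elim: t1 => //= j t1 <-.
have := pderivs_swap i j (smooth_on_pderivs (t1 ++ t2) sf).
by [].
Qed.

Lemma smooth_on_sumP (J : Type) (r : seq J) (c : J -> R[i]) (F : J -> E -> C) :
  (forall j, smooth_on setT (F j)) ->
  smooth_on setT (fun y => \sum_(j <- r) c j * F j y : R[i]) /\
  (forall s x, setT x -> pderivs s (fun y => \sum_(j <- r) c j * F j y : R[i]) x =
     \sum_(j <- r) (c j * pderivs s (F j) x : R[i])).
Proof.
move=> sF; apply: (@smooth_onP _ _ setT _
  (fun s x => \sum_(j <- r) c j * pderivs s (F j) x : R[i])) => //.
- exact: openT.
- move=> s x _; rewrite /prop_for/continuous_at; elim: r => [|j r IH].
    by rewrite big_nil; under eq_fun do rewrite big_nil; exact: (@cvg_cst _ _ _ (nbhs x)).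
  rewrite big_cons; under eq_fun do rewrite big_cons.
  apply: (@cvgD _ _ _ (nbhs x)); last exact: IH.
  by apply: (@cvgM R[i] _ (nbhs x)); [exact: (@cvg_cst _ _ _ (nbhs x))|exact: (sF j s x I).1].
- move=> s i x _.
  apply: (@is_pderiv_sum _ _ _ _ _ (fun j y => c j * pderivs (i :: s) (F j) y : R[i])) => j.
  have := is_pderivM (is_pderiv_cst i (c j) x) (smooth_on_pderiv (sF j) s i I).
  by rewrite mul0r add0r.
Qed.

End Schwarz.

(** * Density of the polynomials in the smooth functions *)

Section Density.
Context {R : realType} {d : nat}.
Local Notation E := 'rV[R]_d.
Local Notation C := (R[i]^o).
Implicit Types (f g : E -> C) (x y : E) (i : 'I_d) (s : seq 'I_d).

(** Mean value theorem on the segment from the face y_i = -a of the box. *)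
Lemma segment_bound (u u' : E -> R) i (a M : R) :
  (forall y, is_derive y (delta_mx 0 i : E) u (u' y)) ->
  (forall y, box a y -> y 0 i = - a -> u y = 0) ->
  (forall y, box a y -> `|u' y| <= M) ->
  forall y, box a y -> `|u y| <= 2 * a * M.
Proof.
move=> du u0 u'M y ya; have := ya i; rewrite ler_norml => /andP[ya1 ya2].
have M0 : 0 <= M by apply: le_trans (u'M _ ya).
have a0 : 0 <= a by have := ya i; exact: le_trans.
pose h := y 0 i + a; have h0 : 0 <= h by rewrite /h; lra.
pose z : E := (- h) *: delta_mx 0 i + y.
have zE t j : (t *: delta_mx 0 i + z) 0 j = if j == i then t - a else y 0 j.
  rewrite !mxE /=; case: eqVneq => [->|_] /=; last by rewrite !mulr0 !add0r.
  by rewrite !mulr1 /h; ring.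
have zbox t : 0 <= t -> t <= h -> box a (t *: delta_mx 0 i + z).
  move=> t0 th j; rewrite zE; case: eqP => _; last exact: ya.
  by rewrite ler_norml; apply/andP; split; rewrite /h in th; lra.
have z0 : u z = 0.
  have := zbox 0 (lexx _) h0; have := zE 0 i; rewrite scale0r add0r eqxx sub0r.
  by move=> zi zb; exact: u0.
have [h0'|h0'] := eqVneq h 0.
  have -> : y = z by rewrite /z h0' oppr0 scale0r add0r.
  by rewrite z0 normr0 mulr_ge0// mulr_ge0.
have hgt0 : 0 < h by rewrite lt_def h0'.
have [t] := mvt_along z hgt0 du; rewrite in_itv/= => /andP[t0 th].
rewrite {1}/z addrA -scalerDl subrr scale0r add0r z0 subr0 => ->.
rewrite normrM ger0_norm// ler_pM//; first by rewrite /h; lra.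
by apply/u'M/zbox; exact: ltW.
Qed.

Lemma face_bound f f' i (a M : R) :
  (forall y, is_pderiv i f y (f' y)) ->
  (forall y, box a y -> y 0 i = - a -> f y = 0) ->
  (forall y, box a y -> cabs (f' y) <= M) ->
  forall y, box a y -> cabs (f y) <= 4 * a * M.
Proof.
move=> df f0 f'M y ya; apply: le_trans (cabs_le _) _.
have -> : 4 * a * M = 2 * a * M + 2 * a * M by ring.
apply: lerD.
  apply: (@segment_bound (fun y => complex.Re (f y)) (fun y => complex.Re (f' y)) i) => //.
  - by move=> z; exact: (df z).1.
  - by move=> z za zi; rewrite f0.
  - by move=> z za; apply: le_trans (Re_le_cabs _) _; exact: f'M.
apply: (@segment_bound (fun y => complex.Im (f y)) (fun y => complex.Im (f' y)) i) => //.
- by move=> z; exact: (df z).2.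
- by move=> z za zi; rewrite f0.
- by move=> z za; apply: le_trans (Im_le_cabs _) _; exact: f'M.
Qed.

(** Monomials centered at the corner (-a, ..., -a) of the box: an antiderivative of
    such a monomial is a monomial that vanishes on the faces through this corner. *)
Definition shifted_monomial (a : R) (al : 'I_d -> nat) : E -> C :=
  fun x => real_complex R (\prod_j (x 0 j + a) ^+ al j).

Lemma shifted_monomialP (a : R) (al : 'I_d -> nat) :
  smooth_on setT (shifted_monomial a al) /\
  (forall s x, setT x -> pderivs s (shifted_monomial a al) x =
     real_complex R (\prod_j ((al j ^_ (count_mem j s))%:R *
       (x 0 j + a) ^+ (al j - count_mem j s)))).
Proof.
pose D j n (t : R) : R := (al j ^_ n)%:R * (t + a) ^+ (al j - n).
have DD j n (t : R) : is_derive t 1 (D j n) (D j n.+1 t).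
  have d1 : is_derive t 1 (id + cst a : R -> R) (1 + 0) by exact: is_deriveD.
  have -> : D j n = (al j ^_ n)%:R \*: ((id + cst a : R -> R) ^+ (al j - n)).
    by apply/funext => u; rewrite /D !fctE.
  apply: (is_derive_eq (is_deriveZ (al j ^_ n)%:R (is_deriveX (al j - n) d1))).
  rewrite /D addr0 /GRing.scale/= mulr1 ffactnSr natrM subnS mulrA.
  by congr (_ * _ * _).
have := smooth_on_prodP DD; rewrite (_ : (fun y => _) = shifted_monomial a al)//.
apply/funext => y; congr (real_complex R _); apply: eq_bigr => j _.
by rewrite /D ffactn0 mul1r subn0.
Qed.

Lemma polyfun_expand (a : R) g : polyfun g ->
  exists l : seq (C * ('I_d -> nat)),
    forall x, g x = \sum_(cb <- l) (cb.1 * shifted_monomial a cb.2 x : R[i]).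
Proof.
elim=> {g} [c|i|f g _ [l lP] _ [m mP]|f g _ [l lP] _ [m mP]].
- exists [:: (c, fun=> 0%N)] => x; rewrite big_seq1 /shifted_monomial/= big1 ?mulr1//.
- pose e1 : 'I_d -> nat := fun j => j == i.
  exists [:: (1, e1); (- real_complex R a, fun=> 0%N)] => x.
  have one : \prod_(j < d) (x 0 j + a) ^+ 0 = 1 by rewrite big1.
  rewrite big_cons big_seq1 /shifted_monomial/= mul1r one rmorph1 mulr1.
  rewrite (bigD1 i)//= [X in _ * X]big1 ?mulr1; last first.
    by move=> j /negPf ji; rewrite /e1 ji.
  by rewrite /e1 eqxx expr1 rmorphD/= addrK.
- by exists (l ++ m) => x; rewrite big_cat/= lP mP.
- exists [seq (cb.1 * ce.1 : R[i], fun j => (cb.2 j + ce.2 j)%N) | cb <- l, ce <- m] => x.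
  rewrite lP mP mulr_suml big_allpairs_dep; apply: eq_bigr => cb _.
  rewrite mulr_sumr; apply: eq_bigr => ce _; rewrite /= mulrACA; congr (_ * _).
  rewrite /shifted_monomial -rmorphM -big_split/=; congr (real_complex R _).
  by apply: eq_bigr => j _; rewrite exprD.
Qed.

Lemma polyfun_shifted_monomial (a : R) al : polyfun (shifted_monomial a al).
Proof.
rewrite /shifted_monomial; under eq_fun do rewrite rmorph_prod.
apply: polyfun_prod => j; under eq_fun do rewrite rmorphXn rmorphD.
elim: (al j) => [|n IH]; first exact: polyfun_cst.
under eq_fun do rewrite exprS; apply: polyfunM => //.
exact: polyfunD (polyfun_coord j) (polyfun_cst _).
Qed.

Lemma smooth_on_polyfun g : polyfun g -> smooth_on setT g.
Proof.
move=> /(polyfun_expand 0)[l lP].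
have [+ _] := @smooth_on_sumP R d _ l (fun cb => cb.1)
  (fun cb => shifted_monomial 0 cb.2) (fun cb => (shifted_monomialP 0 cb.2).1).
by congr smooth_on; apply/funext => x; rewrite lP.
Qed.

Lemma smooth_on_subP f g : smooth_on setT f -> smooth_on setT g ->
  smooth_on setT (fun x => f x - g x) /\
  (forall s x, pderivs s (fun x => f x - g x) x = pderivs s f x - pderivs s g x).
Proof.
move=> sf sg; have E0 : (fun x => f x - g x) = (-1) *: g + f.
  by apply/funext => x; rewrite !fctE scaleN1r addrC.
split; first by rewrite E0; apply: smooth_on_lin => //; exact: openT.
by move=> s x; rewrite E0 (pderivs_lin _ _ openT)// scaleN1r addrC.
Qed.

(** Let W be the word that contains every letter n times, and q a polynomial close
    to the derivative of f along W. Integrating q term by term n times in each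
    variable gives p, whose derivative along W is q. A derivative of f - p of lower
    order in direction i vanishes on the face x_i = -a, hence is bounded by its
    derivative in direction i; letters are added in this way until a permutation
    of W is reached. *)
Lemma polyfun_dense_supported f (a e : R) (n : nat) : 0 < a -> 0 < e ->
  smooth_on setT f -> (forall x i, supp f x -> `|x 0 i| < a) ->
  exists2 p, polyfun p & forall s x, (size s <= n)%N -> box a x ->
    cabs (pderivs s f x - pderivs s p x) <= e.
Proof.
move=> a0 e0 sf fa.
pose W := flatten [seq nseq n j | j <- enum 'I_d].
have countW j : count_mem j W = n.
  rewrite /W count_flatten -map_comp sumnE big_map big_enum/= (bigD1 j)//=.
  by rewrite count_nseq/= eqxx mul1n big1 ?addn0// => k /negPf kj; rewrite count_nseq/= kj.
have cF : continuous (pderivs W f) by move=> x; exact: (sf W x I).1.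
(* [face_bound] is used at most d n times, each time with the factor 4 a. *)
pose e' := e / (1 + 4 * a) ^+ (d * n).
have e'0 : 0 < e' by rewrite divr_gt0// exprn_gt0// addr_gt0// mulr_gt0.
have [q pq qP] := weierstrass cF a0 e'0.
have [l lP] := polyfun_expand a pq.
pose be (cb : C * ('I_d -> nat)) j := (cb.2 j + n)%N.
pose c (cb : C * ('I_d -> nat)) : R[i] :=
  cb.1 * (real_complex R (\prod_j ((be cb j) ^_ n)%:R))^-1.
pose p (x : E) : C := \sum_(cb <- l) (c cb * shifted_monomial a (be cb) x : R[i]).
have pp : polyfun p.
  apply: polyfun_sum => cb; apply: polyfunM; first exact: polyfun_cst.
  exact: polyfun_shifted_monomial.
exists p => //.
have sp := smooth_on_polyfun pp.
have pE s x : pderivs s p x = \sum_(cb <- l) (c cb * real_complex R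
    (\prod_j ((be cb j ^_ (count_mem j s))%:R *
       (x 0 j + a) ^+ (be cb j - count_mem j s)))).
  have [_ ->//] := @smooth_on_sumP R d _ l c
    (fun cb => shifted_monomial a (be cb)) (fun cb => (shifted_monomialP a (be cb)).1).
  by apply: eq_bigr => cb _; rewrite (shifted_monomialP a (be cb)).2.
have [sh hE] := smooth_on_subP sf sp.
set h := fun x => f x - p x in sh hE.
have hW x : pderivs W h x = pderivs W f x - q x.
  rewrite hE lP pE; congr (_ - _); apply: eq_bigr => cb _.
  under eq_bigr do rewrite countW /be addnK.
  rewrite big_split/= rmorphM/= /c mulrA mulrVK// unitfE.
  rewrite (_ : 0 = real_complex R 0)// (inj_eq (fmorph_inj _)).
  apply/prodf_neq0 => j _; rewrite pnatr_eq0 -lt0n ffact_gt0.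
  exact: leq_addl.
have face s i x : (count_mem i s < n)%N -> box a x -> x 0 i = - a -> pderivs s h x = 0.
  move=> si xa xi; rewrite hE pderivs_out ?sub0r; last first.
    by move=> /(fa x i); rewrite xi normrN gtr0_norm// ltxx.
  rewrite pE big1 ?oppr0// => cb _; rewrite (bigD1 i)//= xi addNr expr0n.
  by rewrite subn_eq0 leqNgt (leq_trans si) ?leq_addl//= mulr0 mul0r mulr0.
(* The number of letters that s lacks to be a permutation of W. *)
pose mu s := (\sum_j (n - count_mem j s))%N.
have key m s : mu s = m -> (forall j, (count_mem j s <= n)%N) ->
    forall x, box a x -> cabs (pderivs s h x) <= (4 * a) ^+ m * e'.
  elim: m s => [|m IH] s smu sn x xa.
    have sW : perm_eq s W.
      apply/permP => P; rewrite -!size_filter.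
      suff : perm_eq s W by move/permP; rewrite !size_filter.
      apply/allP => j _ /=; rewrite countW eqn_leq sn /=.
      by move/eqP: smu; rewrite sum_nat_eq0 => /forallP/(_ j); rewrite subn_eq0.
    by rewrite (pderivs_perm sh sW) hW expr0 mul1r; exact: qP.
  have [i si] : exists i, (count_mem i s < n)%N.
    apply: contrapT => /forallNP sn'; move: smu; rewrite /mu big1// => j _.
    by apply/eqP; rewrite subn_eq0 leqNgt; apply/negP.
  rewrite exprS -mulrA.
  apply: (@face_bound _ (pderivs (i :: s) h) i a ((4 * a) ^+ m * e')) xa.
  - by move=> y; exact: (smooth_on_pderiv sh).
  - by move=> y ya yi; exact: face si ya yi.
  - apply: IH => [|j]; last first.
      by rewrite /=; case: eqVneq => [<-|_]; [exact: si|exact: sn].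
    apply: succn_inj; rewrite -smu /mu (bigD1 i)//= [RHS](bigD1 i)//= eqxx add1n.
    rewrite subnS -addSn prednK ?subn_gt0//; congr (_ + _)%N.
    by apply: eq_bigr => j ji; rewrite eq_sym (negPf ji).
move=> s x sn xa; rewrite -hE.
have sle j : (count_mem j s <= n)%N by rewrite (leq_trans (count_size _ _)).
apply: le_trans (key _ s erefl sle x xa) _.
rewrite /e' mulrCA ger_pMr// ler_pdivrMr ?exprn_gt0 ?addr_gt0 ?mulr_gt0// mul1r.
apply: (@le_trans _ _ ((1 + 4 * a) ^+ mu s)).
  by rewrite lerXn2r ?nnegrE ?addr_ge0 ?mulr_ge0 ?(ltW a0)// lerDr.
apply: ler_weXn2l; first by rewrite lerDl mulr_ge0// ltW.
rewrite /mu -[X in (_ <= X * _)%N]card_ord -sum_nat_const leq_sum// => j _.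
exact: leq_subr.
Qed.

Lemma pderivs_eq_on (V : set E) f g s x : open V -> smooth_on V f ->
  (forall y, V y -> f y = g y) -> V x -> pderivs s g x = pderivs s f x.
Proof.
move=> oV sf fg Vx; have fg' : {in V, f =1 g} by move=> y /set_mem; exact: fg.
exact: (smooth_on_eq oV sf fg').2.
Qed.

(** Multiplying f by a function equal to 1 near the box of radius r reduces the
    claim to compact support inside a larger box. *)
Theorem polyfun_dense f (r e : R) (n : nat) : 0 < e -> smooth_on setT f ->
  exists2 p, polyfun p & forall s x, (size s <= n)%N -> box r x ->
    cabs (pderivs s f x - pderivs s p x) <= e.
Proof.
move=> e0 sf.
have [a [sa ca _ [V [oV rV] a1]]] :=
  cutoff_exists (@compact_box R d r) openT (@subsetT _ _).
have [r' r'0 ar'] := compact_sub_box ca.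
have [saf _] := smooth_on_mulP openT sa sf.
pose b := Num.max r r' + 1.
have b0 : 0 < b by rewrite ltr_wpDl// le_max (ltW r'0) orbT.
have supp_af x i : supp (fun y => a y * f y : R[i]) x -> `|x 0 i| < b.
  move=> xs; apply: (@le_lt_trans _ _ r'); last first.
    by rewrite /b (@le_lt_trans _ _ (Num.max r r')) ?ltrDl// le_max lexx orbT.
  apply: ar'; apply: supp_sub xs; first exact: closed_supp.
  by move=> y /suppP->; rewrite mul0r.
have [p pp pP] := polyfun_dense_supported n b0 e0 saf supp_af.
exists p => // s x sn xr.
have <- : pderivs s (fun y => a y * f y : R[i]) x = pderivs s f x.
  apply: (@pderivs_eq_on V) => //; last exact: rV.
    exact: smooth_onS sf.
  by move=> y /a1 ->; rewrite mul1r.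
apply: pP => // i; apply: le_trans (xr i) _.
by rewrite /b (@le_trans _ _ (Num.max r r')) ?lerDl// le_max lexx.
Qed.

End Density.

(** * Seminorm estimates on the spaces of smooth functions *)

Section Estimates.
Context {R : realType} {d : nat}.
Local Notation E := 'rV[R]_d.
Local Notation C := (R[i]^o).
Implicit Types (Om : openset E) (x y : E) (i : 'I_d) (s : seq 'I_d) (K : set E).

Lemma entourage_cabs (W : set (C * C)) : entourage W ->
  exists2 e : R, 0 < e & forall z w : C, cabs (z - w) < e -> W (z, w).
Proof.
rewrite -entourage_ballE => -[[e b] /=]; rewrite ltcE /= => /andP[/eqP b0 e0] eW.
exists e => // z w zw; apply: eW.
by rewrite /= -ball_normE /ball_/= cabsE ltcE/= b0 eqxx.
Qed.

(** The topology of C^oo(Om) in terms of the seminorms sup_K |d^s f|. *)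
Lemma Cinf_cvg_cabsP Om (F : set_system (Cinf Om)) (f : Cinf Om) : Filter F ->
  (F --> f) <-> (forall s K (e : R), compactly_in Om K -> 0 < e ->
    \forall g \near F, forall x, K x -> cabs (pderivs s f x - pderivs s (g : Cinf Om) x) < e).
Proof.
move=> FF; split=> [/Cinf_cvgP Ff s K e KO e0|Ff].
  have h := Ff s K KO.
  apply: (h [set k | forall y, K y -> cabs (pderivs s f y - k y) < e]).
  apply/uniform_nbhs; exists [set p : C * C | cabs (p.1 - p.2) < e]; split => //.
  rewrite -entourage_ballE; exists (real_complex R e); first by rewrite /= ltcR.
  by move=> [z w]; rewrite /= -ball_normE /ball_/= cabsE ltcR.
apply/Cinf_cvgP => s K KO U /uniform_nbhs[W [entW WU]].
have [e e0 eW] := entourage_cabs entW.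
apply: filterS (Ff s K e KO e0) => g gK; apply: WU => y Ky; apply: eW.
exact: gK.
Qed.

Definition jet_le K (n : nat) (e : R) (f : E -> C) : Prop :=
  forall s x, (size s <= n)%N -> K x -> cabs (pderivs s f x) <= e.

Lemma jet_leS K K' n n' e e' f : K' `<=` K -> (n' <= n)%N -> e <= e' ->
  jet_le K n e f -> jet_le K' n' e' f.
Proof.
move=> KK nn ee fK s x sn Kx; apply: le_trans ee; apply: fK; last exact: KK.
exact: leq_trans nn.
Qed.

Lemma pderivs0 s x : pderivs s (fun _ : E => 0 : C) x = 0.
Proof.
apply: pderivs_out; rewrite (_ : supp _ = set0) => //.
by rewrite -subset0; apply: supp_sub => //; exact: closed0.
Qed.

Lemma Cinf_pderivs_lin Om (a : R[i]) (f g : Cinf Om) s x : (Om : set E) x ->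
  pderivs s (a *: f + g) x = a *: pderivs s f x + pderivs s g x.
Proof.
apply: (@pderivs_lin _ _ Om f g a); [exact: openset_open|exact: Cinf_smooth|exact: Cinf_smooth].
Qed.

Lemma Cinf_pderivsB Om (f g : Cinf Om) s x : (Om : set E) x ->
  pderivs s (f - g : Cinf Om) x = pderivs s f x - pderivs s g x.
Proof.
move=> Ox; have := Cinf_pderivs_lin (-1) g f s Ox.
by rewrite !scaleN1r addrC => ->; rewrite addrC.
Qed.

Lemma Cinf_pderivsZ Om (a : R[i]) (f : Cinf Om) s x : (Om : set E) x ->
  pderivs s (a *: f : Cinf Om) x = a *: pderivs s f x.
Proof.
move=> Ox; have := Cinf_pderivs_lin a f 0 s Ox; rewrite addr0 => ->.
by rewrite [X in _ + X]pderivs0 addr0.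
Qed.

Lemma near_jet_le Om (f : Cinf Om) K n (e : R) : compactly_in Om K -> 0 < e ->
  \forall g \near f, jet_le K n e (g - f : Cinf Om).
Proof.
move=> KO e0; have FF : Filter (nbhs f) by exact: nbhs_filter.
have /Cinf_cvg_cabsP ff : nbhs f --> f by [].
pose P (k : nat) (t : k.-tuple 'I_d) : set (Cinf Om) :=
  [set g | forall x, K x -> cabs (pderivs t (g - f : Cinf Om) x) <= e].
have h k (t : k.-tuple 'I_d) : nbhs f (P k t).
  apply: filterS (ff t K e KO e0) => g gK x Kx.
  rewrite (Cinf_pderivsB g f); last exact: KO.1.
  by rewrite cabsB; apply: ltW; exact: gK.
have hk k := filter_forall (F := nbhs f) FF (h k).
have := filter_forall (F := nbhs f) FF (fun k : 'I_n.+1 => hk k).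
apply: filterS => g gK s x sn Kx.
exact: (gK (Ordinal (sn : (size s < n.+1)%N)) (in_tuple s) x Kx).
Qed.

(** The sets [jet_le K n e] generate a filter that converges to 0. *)
Lemma nbhs0_jet_le Om (U : set (Cinf Om)) : nbhs (0 : Cinf Om) U ->
  exists K n (e : R), [/\ compactly_in Om K, 0 < e &
    forall f : Cinf Om, jet_le K n e f -> U f].
Proof.
pose D := [set p : set E * nat * R | compactly_in Om p.1.1 /\ 0 < p.2].
pose B (p : set E * nat * R) := [set f : Cinf Om | jet_le p.1.1 p.1.2 p.2 f].
pose F := filter_from D B.
have FF : Filter F.
  apply: filter_from_filter.
    by exists (set0, 0%N, 1); split => //; split; [exact: sub0set|exact: compact0].
  move=> [[K n] e] [[K' n'] e'] [/= [KO cK] e0] [/= [KO' cK'] e'0].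
  exists (K `|` K', maxn n n', Num.min e e').
    split; rewrite /= ?lt_min ?e0//; split; last exact: compactU.
    by move=> x [/KO|/KO'].
  move=> f fK; split; apply: jet_leS fK.
  - by move=> x Kx; left.
  - exact: leq_maxl.
  - by rewrite ge_min lexx.
  - by move=> x Kx; right.
  - exact: leq_maxr.
  - by rewrite ge_min lexx orbT.
have F0 : F --> (0 : Cinf Om).
  apply/Cinf_cvg_cabsP => s K e KO e0.
  exists (K, size s, e / 2); first by split => //=; rewrite divr_gt0.
  move=> f fK x Kx; rewrite [X in X - _]pderivs0 sub0r cabsN.
  by apply: le_lt_trans (fK s x (leqnn _) Kx) _ => /=; rewrite ltr_pdivrMr//; lra.
by move=> /F0[[[K n] e] [/= KO e0] KU]; exists K, n, e; split.
Qed.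

Definition jet_bounded Om (phi : Cinf Om -> C) K n (B : R) : Prop :=
  forall (f : Cinf Om) (e : R), 0 < e -> jet_le K n e f -> cabs (phi f) <= B * e.

Lemma cabs_scale (a : R) (z : C) : 0 < a -> cabs (real_complex R a *: z) = a * cabs z.
Proof. by move=> a0; rewrite [X in cabs X]/(_ *: _)/= cabsM cabs_real gtr0_norm. Qed.

(** By homogeneity, a bound on a neighborhood of 0 is an estimate by a seminorm; the
    index set I makes the seminorm uniform in a family of functionals. *)
Lemma jet_bounded_of_nbhs0 Om (I : Type) (phi : I -> Cinf Om -> C) :
  (forall j a f, phi j (a *: f) = a *: phi j f) ->
  nbhs (0 : Cinf Om) [set f | forall j, cabs (phi j f) <= 1] ->
  exists K n, exists2 B : R, 0 < B & compactly_in Om K /\ forall j, jet_bounded (phi j) K n B.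
Proof.
move=> phiZ /nbhs0_jet_le[K [n [r [KO r0 rP]]]].
exists K, n, r^-1; first by rewrite invr_gt0.
split=> // j f e e0 fK.
have re0 : 0 < r / e by rewrite divr_gt0.
have fr : jet_le K n r (real_complex R (r / e) *: f : Cinf Om).
  move=> s x sn Kx; rewrite Cinf_pderivsZ; last exact: KO.1.
  rewrite cabs_scale// -[leRHS](divfK (lt0r_neq0 e0)) ler_pM2l//.
  exact: fK.
have := rP _ fr j; rewrite phiZ cabs_scale//.
by rewrite -ler_pdivlMl// mulr1 invf_div mulrC.
Qed.

Lemma jet_bounded_continuous Om (phi : Cinf Om -> C) K n B : 0 < B ->
  (forall f g, phi (f - g) = phi f - phi g) ->
  compactly_in Om K -> jet_bounded phi K n B -> continuous phi.
Proof.
move=> B0 phiB KO phiK f; rewrite /continuous_at.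
apply: ((cvg_cabsP phi (phi f) (nbhs_filter f)).2) => e e0.
have eB : 0 < e / (2 * B) by rewrite divr_gt0// mulr_gt0.
have ng := @near_jet_le Om f K n _ KO eB.
have FF : Filter (nbhs f) by exact: nbhs_filter.
apply: filterS ng => g gf.
rewrite -cabsN opprB -phiB; apply: le_lt_trans (phiK _ _ eB gf) _.
have -> : B * (e / (2 * B)) = e / 2 by field; rewrite gt_eqF.
by rewrite ltr_pdivrMr//; lra.
Qed.

End Estimates.

(** * Dilations and multiplications as continuous operators *)

Section Operators.
Context {R : realType} {d : nat}.
Local Notation E := 'rV[R]_d.
Local Notation C := (R[i]^o).
Implicit Types (Om : openset E) (x y : E) (i : 'I_d) (s : seq 'I_d) (K : set E).

Lemma linear_distr Om (T : distr Om) : linear T.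
Proof. by have /asboolP[] := strong_dual_funP T. Qed.

Lemma continuous_distr Om (T : distr Om) : continuous T.
Proof. by have /asboolP[] := strong_dual_funP T. Qed.

Lemma linear_fun0 (U V : lmodType R[i]) (L : U -> V) : linear L -> L 0 = 0.
Proof.
by move=> lL; have := lL (-1) 0 0; rewrite !scaleN1r !addNr.
Qed.

Lemma linear_funB (U V : lmodType R[i]) (L : U -> V) f g : linear L -> L (f - g) = L f - L g.
Proof.
by move=> lL; rewrite addrC -scaleN1r lL scaleN1r addrC.
Qed.

Lemma linear_funZ (U V : lmodType R[i]) (L : U -> V) a f : linear L -> L (a *: f) = a *: L f.
Proof.
by move=> lL; rewrite -[a *: f]addr0 lL linear_fun0// addr0.
Qed.

Definition mkdistr Om (phi : Cinf Om -> C) (lphi : linear phi) (cphi : continuous phi) :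
    distr Om :=
  MkStrongDual (asboolT (conj lphi cphi) : phi \in @strong_dual_pred _ (Cinf Om)).

Lemma distr_jet_bounded Om (T : distr Om) : exists K n, exists2 B : R, 0 < B &
  compactly_in Om K /\ jet_bounded T K n B.
Proof.
have [||K [n [B B0 [KO KB]]]] := @jet_bounded_of_nbhs0 R d Om unit (fun _ => T).
- by move=> _ a f; exact/linear_funZ/linear_distr.
- have := @continuous_distr Om T 0.
  move=> /((cvg_cabsP T (T 0) (nbhs_filter _)).1)/(_ 1 ltr01).
  have FF : Filter (nbhs (0 : Cinf Om)) by exact: nbhs_filter.
  apply: filterS => f; rewrite linear_fun0; last exact: linear_distr.
  by rewrite sub0r cabsN => /ltW ? _.
by exists K, n, B => //; split => //; exact: (KB tt).
Qed.

(** The estimate is uniform in x, which is what controls the supports near a given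
    point in [has_moments_distr_in]. *)
Lemma jet_bounded_map Om Om' (M : Cinf Om -> Cinf Om') K' : linear M -> continuous M ->
  compactly_in Om' K' ->
  exists K n, exists2 B : R, 0 < B & compactly_in Om K /\
    forall x, K' x -> jet_bounded (fun f => M f x) K n B.
Proof.
move=> lM cM KO'.
have [||K [n [B B0 [KO KB]]]] :=
  @jet_bounded_of_nbhs0 R d Om {x | K' x} (fun j f => M f (sval j)).
- by move=> j a f; rewrite linear_funZ.
- have h := @near_jet_le R d Om' 0 K' 0%N 1 KO' ltr01.
  have FF : Filter (nbhs (0 : Cinf Om)) by exact: nbhs_filter.
  have FF' : Filter (nbhs (0 : Cinf Om')) by exact: nbhs_filter.
  have h' : nbhs (M 0) [set g : Cinf Om' | jet_le K' 0%N 1 g].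
    by rewrite linear_fun0//; apply: filterS h => g; rewrite subr0.
  have h'' : nbhs (0 : Cinf Om) (M @^-1` [set g : Cinf Om' | jet_le K' 0%N 1 g]).
    exact: cM h'.
  apply: filterS h'' => f /= fK [x Kx] /=; exact: (fK [::] x isT Kx).
by exists K, n, B => //; split => // x Kx; exact: (KB (exist _ x Kx)).
Qed.

Lemma continuous_jet_bounded_map Om Om' (L : Cinf Om -> Cinf Om') : linear L ->
  (forall s K', compactly_in Om' K' -> exists K n, exists2 B : R, 0 < B &
     compactly_in Om K /\
     forall x, K' x -> jet_bounded (fun f => pderivs s (L f) x) K n B) ->
  continuous L.
Proof.
move=> lL LK f; have FF : Filter (nbhs f) by exact: nbhs_filter.
apply/Cinf_cvg_cabsP => s K' e KO' e0.
have [K [n [B B0 [KO KB]]]] := LK s K' KO'.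
have eB : 0 < e / (2 * B) by rewrite divr_gt0// mulr_gt0.
have ng := @near_jet_le R d Om f K n _ KO eB.
rewrite /near_simpl/=; apply: filterS ng => g gf /= x Kx.
have := KB x Kx _ _ eB gf; rewrite linear_funB// Cinf_pderivsB; last exact: KO'.1.
rewrite cabsB => /le_lt_trans; apply.
have -> : B * (e / (2 * B)) = e / 2 by field; rewrite gt_eqF.
by rewrite ltr_pdivrMr//; lra.
Qed.

Lemma pderivs_hmul (A : openset E) (f : E -> C) (x : E) s y :
  smooth_on A f -> (A : set E) (hmul x y) ->
  pderivs s (f \o hmul x) y =
  real_complex R (\prod_(i <- s) x 0 i) *: pderivs s f (hmul x y).
Proof.
move=> sf; elim: s y => [|i s IH] y Ay; first by rewrite big_nil scale1r.
have oA : open (dilate_set A x) by exact: openset_open.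
apply: is_pderiv_val; pose c := \prod_(i <- s) x 0 i.
apply: (@is_pderiv_near _ _ _ (real_complex R c \*: (pderivs s f \o hmul x))).
  have : nbhs y (dilate_set A x : set E) by apply: open_nbhs_nbhs; split.
  by apply: filterS => z Az; exact/esym/IH.
have [h1 h2] := smooth_on_pderiv sf s i Ay.
have -> : real_complex R (\prod_(j <- i :: s) x 0 j) *: pderivs (i :: s) f (hmul x y) =
    real_complex R c *: (real_complex R (x 0 i) *: pderivs (i :: s) f (hmul x y)) + 0.
  by rewrite addr0 scalerA -rmorphM big_cons mulrC.
rewrite -[X in is_pderiv _ X]addr0; apply: is_pderiv_lin; last exact: is_pderiv_cst.
have ReM (k : R) (z : C) : complex.Re (real_complex R k *: z) = k * complex.Re z.
  by case: z => ? ? /=; rewrite mul0r subr0.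
have ImM (k : R) (z : C) : complex.Im (real_complex R k *: z) = k * complex.Im z.
  by case: z => ? ? /=; rewrite mul0r addr0.
by split; [rewrite ReM|rewrite ImM]; exact: is_derive_hmul.
Qed.

Definition dilate Om Om' (x : E) (f : Cinf Om) : Cinf Om' := toCinf Om' (f \o hmul x).

Section Dilation.
Variables (Om Om' : openset E) (x : E).
Hypothesis xO : forall y, (Om' : set E) y -> (Om : set E) (hmul x y).

Lemma smooth_on_dilate (f : Cinf Om) : smooth_on Om' (f \o hmul x).
Proof.
apply: (@smooth_onS _ _ _ (dilate_set Om x)); first by move=> y /xO.
exact/smooth_on_hmul/Cinf_smooth.
Qed.

Lemma dilateE (f : Cinf Om) y : (Om' : set E) y -> dilate Om' x f y = f (hmul x y).
Proof. by move=> Oy; rewrite /dilate toCinfE//; [exact: smooth_on_dilate|exact/mem_set]. Qed.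

Lemma pderivs_dilate (f : Cinf Om) s y : (Om' : set E) y ->
  pderivs s (dilate Om' x f) y =
  real_complex R (\prod_(i <- s) x 0 i) *: pderivs s f (hmul x y).
Proof.
move=> Oy; rewrite -(pderivs_hmul s (Cinf_smooth f) (xO Oy)).
apply: (@pderivs_eq_on _ _ Om') => //; [exact: openset_open|exact: smooth_on_dilate|].
by move=> z Oz; rewrite dilateE.
Qed.

Lemma linear_dilate : linear (@dilate Om Om' x).
Proof.
move=> a f g; apply: Cinf_eqP => y /set_mem Oy; rewrite dilateE//.
by rewrite -[RHS]/(a *: dilate Om' x f y + dilate Om' x g y) !dilateE.
Qed.

Lemma compact_hmul K : compact K -> compact (hmul x @` K).
Proof.
by apply: continuous_compact; apply: continuous_subspaceT; exact: hmul_continuous.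
Qed.

Lemma continuous_dilate : continuous (@dilate Om Om' x).
Proof.
apply: (continuous_jet_bounded_map linear_dilate) => s K' [KO' cK'].
pose c : R := `|\prod_(i <- s) x 0 i| + 1.
have c0 : 0 < c by rewrite ltr_wpDl.
exists (hmul x @` K'), (size s), c => //; split.
  by split; [move=> _ [y /KO' Oy <-]; exact: xO|exact: compact_hmul].
move=> y Ky f e e0 fK; rewrite pderivs_dilate; last exact: KO'.
rewrite [X in cabs X]/(_ *: _)/= cabsM cabs_real ler_pM//; first exact: cabs_ge0.
  by rewrite lerDl.
by apply: fK => //; exists y.
Qed.

End Dilation.

(** As f vanishes outside Om, this is the extension by 0 of the product when the
    support of a lies in Om; for Om = R^d it is the product. *)
Definition cutmul Om (a : E -> C) (f : Cinf Om) : Cinf (@openT_set E) :=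
  toCinf openT_set (fun y => a y * f y : R[i]).

Section Cutmul.
Variables (Om : openset E) (a : E -> C).
Hypotheses (sa : smooth_on setT a) (aO : supp a `<=` Om).

Lemma smooth_on_cutmul (f : Cinf Om) : smooth_on setT (fun y => a y * f y : R[i]).
Proof.
have oO := openset_open Om.
have [sO _] := smooth_on_mulP oO (smooth_onS (@subsetT _ _) sa) (Cinf_smooth f).
have oS : open (~` supp a) by apply: closed_openC; exact: closed_supp.
have [sS _] : smooth_on (~` supp a) (fun y => a y * f y : R[i]) /\ True.
  split => //; have : smooth_on (~` supp a) (fun _ : E => 0 : C) by exact: smooth_on_cst.
  move=> s0; have e0 : {in ~` supp a, (fun=> 0) =1 (fun y => a y * f y : R[i])}.
    by move=> y /set_mem /suppP ->; rewrite mul0r.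
  exact: (smooth_on_eq oS s0 e0).1.
by move=> s x _; have [/aO Ox|nx] := pselect (supp a x); [exact: sO|exact: sS].
Qed.

Lemma cutmulE (f : Cinf Om) y : cutmul a f y = (a y * f y : R[i]).
Proof.
by apply: (@toCinfE R d openT_set _ (smooth_on_cutmul f)); exact/mem_set.
Qed.

Lemma linear_cutmul : linear (@cutmul Om a).
Proof.
move=> c f g; apply: Cinf_eqP => y _; rewrite cutmulE.
rewrite -[RHS]/(c *: cutmul a f y + cutmul a g y) !cutmulE.
rewrite -[(c *: f + g) y]/(c * f y + g y) -[c *: _]/(c * _).
by rewrite mulrDr mulrCA.
Qed.

Lemma cutmul_out (f : Cinf Om) s x : ~ supp a x -> pderivs s (cutmul a f) x = 0.
Proof.
move=> nx; apply: pderivs_out => xs; apply: nx; apply: supp_sub xs.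
  exact: closed_supp.
by move=> y /suppP ay; rewrite cutmulE ay mul0r.
Qed.

Lemma continuous_cutmul : continuous (@cutmul Om a).
Proof.
apply: (continuous_jet_bounded_map linear_cutmul) => s K' [_ cK'].
have cK : compact (K' `&` supp a).
  exact: compact_closedI cK' (@closed_supp _ _ _).
have /choice[A AP] t : exists A : R, 0 < A /\
    forall x, (K' `&` supp a) x -> cabs (pderivs t a x) <= A.
  have [B B0 BP] := compact_bounded_fun cK (fun x _ => (sa t (x := x) I).1).
  by exists B.
pose B := 1 + \sum_(ab <- leibniz s) A ab.1.
have B0 : 0 < B.
  by rewrite ltr_wpDr// sumr_ge0// => ab _; exact/ltW/(AP _).1.
exists (K' `&` supp a), (size s), B => //; split.
  by split => // x [_ /aO].
move=> x Kx f e e0 fK.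
have [xa|/cutmul_out ->] := pselect (supp a x); last first.
  by rewrite cabs0 mulr_ge0 ?ltW.
have oO := openset_open Om.
have [sO sE] := smooth_on_mulP oO (smooth_onS (@subsetT _ _) sa) (Cinf_smooth f).
have -> : pderivs s (cutmul a f) x = pderivs s (fun y => a y * f y : R[i]) x.
  apply: (@pderivs_eq_on _ _ Om) => //; last exact: aO.
  by move=> y _; rewrite cutmulE.
rewrite sE; last exact: aO.
apply: le_trans (cabs_sum _ _ _) _.
rewrite /B mulrDl mul1r ler_wpDl ?(ltW e0)// mulr_suml.
rewrite big_seq [leRHS]big_seq; apply: ler_sum => ab abs.
rewrite cabsM ler_pM ?cabs_ge0//; first exact: (AP _).2.
by apply: fK => //; rewrite -(leibniz_size abs) leq_addl.
Qed.

End Cutmul.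

End Operators.

(** * Supports and localization of distributions *)

Section Supports.
Context {R : realType} {d : nat}.
Local Notation E := 'rV[R]_d.
Local Notation C := (R[i]^o).
Local Notation Eall := (@openT_set E).
Implicit Types (Om : openset E) (x y : E) (i : 'I_d) (s : seq 'I_d) (K : set E).
Implicit Types (T : distr Eall).

(** The estimate holds with every e > 0. *)
Lemma jet_bounded_eq0 Om (phi : Cinf Om -> C) K n (B : R) (f : Cinf Om) :
  0 < B -> jet_bounded phi K n B ->
  (forall s x, K x -> pderivs s f x = 0) -> phi f = 0.
Proof.
move=> B0 phiK f0; apply: cabs_eq0; apply/eqP; rewrite eq_le cabs_ge0 andbT.
apply/ler_addgt0Pl => e e0; rewrite addr0.
have eB : 0 < e / B by rewrite divr_gt0.
have -> : e = B * (e / B) by rewrite mulrC divfK ?gt_eqF.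
by apply: phiK => // s x _ Kx; rewrite f0// cabs0 ltW.
Qed.

Lemma jet_bounded_eq Om (phi : Cinf Om -> C) K n (B : R) (f g : Cinf Om) : linear phi -> 0 < B ->
  compactly_in Om K -> jet_bounded phi K n B ->
  (forall s x, K x -> pderivs s f x = pderivs s g x) -> phi f = phi g.
Proof.
move=> lphi B0 KO phiK fg; apply/eqP; rewrite -subr_eq0 -linear_funB//; apply/eqP.
apply: jet_bounded_eq0 phiK _ => // s x Kx; rewrite Cinf_pderivsB; last exact: KO.1.
by rewrite fg// subrr.
Qed.

Lemma distr_eq Om (S S' : distr Om) : S =1 S' -> S = S'.
Proof. by move=> SS; apply/val_inj/funext. Qed.

Lemma cutmul_near (Om : openset E) (a : E -> C) (V : set E) (f : Cinf Om) s x :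
  smooth_on setT a -> supp a `<=` Om -> open V -> (forall y, V y -> a y = 1) ->
  V x -> (Om : set E) x -> pderivs s (cutmul a f) x = pderivs s f x.
Proof.
move=> sa aO oV a1 Vx Ox; have oO := openset_open Om.
apply: (@pderivs_eq_on _ _ (V `&` Om)) => //; first exact: openI.
- by apply: smooth_onS (Cinf_smooth f) => y [].
- by move=> y [Vy _]; rewrite cutmulE// a1// mul1r.
Qed.

(** A function f on Om and its product with a cut-off function have the same
    derivatives on the compact sets that carry S and S', and the product is the
    restriction of a smooth function of R^d. *)
Lemma extend_inj Om (S S' : distr Om) : extend S = extend S' -> S = S'.
Proof.
move=> SS; apply: distr_eq => f.
have [K [n [B B0 [[KO cK] KB]]]] := distr_jet_bounded S.
have [K' [n' [B' B'0 [[KO' cK'] KB']]]] := distr_jet_bounded S'.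
have [|||a [sa ca aO [V [oV KV] a1]]] := @cutoff_exists _ _ (K `|` K') Om.
- exact: compactU.
- exact: openset_open.
- by move=> x [/KO|/KO'].
have E0 s x : (K `|` K') x -> pderivs s f x = pderivs s (restr Om (cutmul a f)) x.
  move=> Kx; have Ox : (Om : set E) x by case: Kx => [/KO|/KO'].
  rewrite -(cutmul_near f s sa aO oV a1)//; last exact: KV.
  apply/esym/(@pderivs_eq_on _ _ Om) => //; first exact: openset_open.
    exact: smooth_onS (Cinf_smooth _).
  by move=> y Oy; rewrite restrE//; exact/mem_set.
have := congr1 (fun T : distr Eall => T (cutmul a f)) SS.
rewrite /= -(jet_bounded_eq (linear_distr S) B0 (conj KO cK) KB (f := f)).
  rewrite -(jet_bounded_eq (linear_distr S') B'0 (conj KO' cK') KB' (f := f)) => [//|].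
  by move=> s x Kx; apply: E0; right.
by move=> s x Kx; apply: E0; left.
Qed.

Lemma distr_supp_carrier T K n (B : R) : 0 < B -> compact K -> jet_bounded T K n B ->
  distr_supp T `<=` K.
Proof.
move=> B0 cK TK; apply: subsetCl => x Kx; exists (~` K) => //; split.
  by apply: closed_openC; apply: compact_closed cK; exact: norm_hausdorff.
move=> f S cS SK; apply: jet_bounded_eq0 TK _ => // s y Ky.
by apply: pderivs_out => /SK.
Qed.

Lemma closed_distr_supp T : closed (distr_supp T).
Proof. by apply: open_closedC; apply: bigcup_open => U []. Qed.

Lemma compact_distr_supp T : compact (distr_supp T).
Proof.
have [K [n [B B0 [[_ cK] KB]]]] := distr_jet_bounded T.
exact: (subclosed_compact (@closed_distr_supp T) cK (distr_supp_carrier B0 cK KB)).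
Qed.

(** The functions a such that T (a g) = 0 for all g contain the bumps supported in an
    open set on which T vanishes, and they satisfy the hypotheses of
    [plateau_on_compact]; one of them equals 1 near the support of w. *)
Lemma distr_off_support T (w : Cinf Eall) : compact (supp w) ->
  (forall x, supp w x -> ~ distr_supp T x) -> T w = 0.
Proof.
move=> cw wT.
pose B : set (E -> C) := [set a : E -> C |
  smooth_on setT a /\ forall g : Cinf Eall, T (cutmul a g) = 0].
have sT (a : E -> C) : supp a `<=` Eall by move=> ? _.
have cutmul0 (a : E -> C) (g : Cinf Eall) : (forall y, a y = 0) -> cutmul a g = 0.
  move=> a0; have sa : smooth_on setT a.
    by rewrite (_ : a = fun=> 0); [exact: smooth_on_cst|exact/funext].
  by apply: Cinf_eqP => y _; rewrite cutmulE// a0 mul0r.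
have [||x xw|a [sa Ta] [V [_ wV] a1]] := @plateau_on_compact _ _ B _ cw.
- split=> [|g]; first exact: smooth_on_cst.
  by rewrite cutmul0// linear_fun0//; exact: linear_distr.
- move=> a b [sa Ta] [sb Tb]; have sab := smooth_on_comb openT sa sb.
  split=> // g.
  rewrite (_ : cutmul _ g = 1 *: cutmul a g + (cutmul b g - cutmul a (cutmul b g))).
    rewrite linear_distr Ta linear_funB; last exact: linear_distr.
    by rewrite Ta Tb subrr scaler0 addr0.
  apply: Cinf_eqP => y _; rewrite cutmulE//.
  rewrite -[RHS]/(1 *: cutmul a g y + (cutmul b g y - cutmul a (cutmul b g) y)).
  by rewrite !cutmulE// scale1r; ring.
- have [U [oU TU] Ux] : (\bigcup_(U in [set U | open U /\ vanishes_on T U]) U) x.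
    by apply: contrapT => nx; exact: wT xw nx.
  have [b [sb cb bU bV]] := bump_exists oU Ux.
  exists b => //; split => // g.
  have h : supp (cutmul b g) `<=` supp b.
    apply: supp_sub; first exact: closed_supp.
    by move=> y /suppP by0; rewrite cutmulE// by0 mul0r.
  apply: TU; last exact: subset_trans h bU.
  exact: (subclosed_compact (@closed_supp _ _ _) cb h).
rewrite (_ : w = cutmul a w)//; apply: Cinf_eqP => y _; rewrite cutmulE//.
have [/wV/a1 ->|/suppP ->] := pselect (supp w y); first by rewrite mul1r.
by rewrite mulr0.
Qed.

(** With a cut-off function a supported in Om and equal to 1 near the support of T,
    put S f = T (a f). Then T ((1 - a) g) = 0, because (1 - a) g, cut off around a
    compact set that carries T, has compact support away from the support of T. *)
Lemma localize T Om : distr_supp T `<=` Om -> exists S : distr Om, extend S = T.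
Proof.
move=> TO.
have [a [sa ca aO [V [oV TV] a1]]] :=
  cutoff_exists (@compact_distr_supp T) (openset_open Om) TO.
have lphi : linear (fun f : Cinf Om => T (cutmul a f)).
  by move=> c f g; rewrite linear_cutmul// linear_distr.
have cphi : continuous (fun f : Cinf Om => T (cutmul a f)).
  move=> f; apply: (@continuous_comp _ _ _ (@cutmul _ _ Om a) T).
    exact: continuous_cutmul.
  exact: continuous_distr.
exists (mkdistr lphi cphi); apply: distr_eq => f /=.
have sT (b : E -> C) : supp b `<=` Eall by move=> ? _.
have -> : cutmul a (restr Om f) = cutmul a f.
  apply: Cinf_eqP => y _; rewrite !cutmulE//.
  have [/aO/mem_set/restrE ->//|/suppP ->] := pselect (supp a y).
  by rewrite !mul0r.
have [K [n [B B0 [KO KB]]]] := distr_jet_bounded T.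
have [b [sb cb _ [W [oW KW] b1]]] := cutoff_exists KO.2 openT (@subsetT _ _).
pose g := f - cutmul a f : Cinf Eall.
have Tg : T g = T (cutmul b g).
  apply: (jet_bounded_eq (linear_distr T) B0 KO KB) => s x Kx.
  by apply/esym/cutmul_near; [exact: sb|exact: sT|exact: oW|exact: b1|exact: KW|].
have gE y : g y = (f y - a y * f y : R[i]).
  by rewrite -[LHS]/(f y - cutmul a f y) cutmulE.
suff : T g = 0.
  rewrite linear_funB; last exact: linear_distr.
  by move=> /eqP; rewrite subr_eq0 => /eqP.
rewrite Tg; apply: distr_off_support.
  have h : supp (cutmul b g) `<=` supp b.
    apply: supp_sub; first exact: closed_supp.
    by move=> y /suppP by0; rewrite cutmulE// by0 mul0r.
  exact: (subclosed_compact (@closed_supp _ _ _) cb h).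
move=> x xs /TV Vx; have : (~` V) x; last by apply.
apply: supp_sub xs; first exact: open_closedC.
move=> y /contrapT Vy; rewrite cutmulE// gE a1// mul1r.
by rewrite [X in _ * X]subrr mulr0.
Qed.

End Supports.

(** * Distributions are determined by their moments *)

Section Moments.
Context {R : realType} {d : nat}.
Local Notation E := 'rV[R]_d.
Local Notation C := (R[i]^o).
Local Notation Eall := (@openT_set E).
Implicit Types (Om : openset E) (x y : E) (i : 'I_d) (s : seq 'I_d) (K : set E).
Implicit Types (S T : distr Eall) (al : 'I_d -> nat).

Definition Cinf_monomial al : Cinf Eall := toCinf Eall (monomial al).

Lemma toCinfTE (f : E -> C) x : smooth_on setT f -> toCinf Eall f x = f x.
Proof. by move=> sf; apply: (@toCinfE R d Eall _ sf); exact/mem_set. Qed.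

Lemma Cinf_monomialE al x : Cinf_monomial al x = monomial al x.
Proof. by rewrite /Cinf_monomial toCinfTE//; exact: smooth_on_monomial. Qed.

Lemma restr_monomial Om al : restr Om (Cinf_monomial al) = toCinf Om (monomial al).
Proof.
apply: Cinf_eqP => x xO; rewrite restrE// Cinf_monomialE toCinfE//.
exact: smooth_on_monomial.
Qed.

Lemma monomial_hmul al x y :
  monomial al (hmul x y) = (monomial al x * monomial al y : R[i]).
Proof.
rewrite /monomial -rmorphM -big_split/=; congr (real_complex R _).
by apply: eq_bigr => j _; rewrite mxE exprMn.
Qed.

Lemma sum_linear_fun (U V : lmodType R[i]) (L : U -> V) (I : Type) (r : seq I)
    (c : I -> R[i]) (F : I -> U) : linear L ->
  L (\sum_(j <- r) c j *: F j) = \sum_(j <- r) c j *: L (F j).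
Proof.
move=> lL; elim: r => [|j r IH]; first by rewrite !big_nil linear_fun0.
by rewrite !big_cons lL IH.
Qed.

Lemma Cinf_sumE Om (I : Type) (r : seq I) (c : I -> R[i]) (F : I -> Cinf Om) x :
  (\sum_(j <- r) c j *: F j) x = \sum_(j <- r) (c j * F j x : R[i]).
Proof. exact: (@sum_linear_fun (Cinf Om) C (fun f => f x)). Qed.

Lemma polyfun_monomial p : polyfun p -> exists l : seq (C * ('I_d -> nat)),
  toCinf Eall p = \sum_(cb <- l) (cb.1 : R[i]) *: Cinf_monomial cb.2.
Proof.
move=> pp; have [l lP] := polyfun_expand 0 pp; exists l.
apply: Cinf_eqP => x _; rewrite Cinf_sumE toCinfTE; last exact: smooth_on_polyfun.
rewrite lP; apply: eq_bigr => cb _; rewrite Cinf_monomialE; congr (_ * real_complex R _).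
by apply: eq_bigr => j _; rewrite addr0.
Qed.

Lemma jet_le_toCinf (f : Cinf Eall) (p : E -> C) r n (e : R) : smooth_on setT p ->
  (forall s x, (size s <= n)%N -> box r x -> cabs (pderivs s f x - pderivs s p x) <= e) ->
  jet_le (box r) n e (f - toCinf Eall p : Cinf Eall).
Proof.
move=> sp fp s x sn xr; rewrite Cinf_pderivsB//.
rewrite (_ : pderivs s (toCinf Eall p) x = pderivs s p x); first exact: fp.
by apply: (@pderivs_eq_on _ _ setT) => //; [exact: openT|move=> y _; rewrite toCinfTE].
Qed.

(** The difference D of the two vanishes on polynomials; D f = D (f - p) is small
    when the polynomial p is close to f in the seminorm that controls D. *)
Theorem moments_determine S T : (forall al, S (Cinf_monomial al) = T (Cinf_monomial al)) -> S = T.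
Proof.
move=> ST; apply: distr_eq => f; apply/eqP; rewrite -subr_eq0.
pose D : distr Eall := S - T.
suff : D f = 0 by move=> /eqP.
have D0 al : D (Cinf_monomial al) = 0.
  by rewrite -[LHS]/(S (Cinf_monomial al) - T (Cinf_monomial al)) ST subrr.
have [K [n [B B0 [KO KB]]]] := distr_jet_bounded D.
have [r r0 Kr] := compact_sub_box KO.2.
apply: cabs_eq0; apply/eqP; rewrite eq_le cabs_ge0 andbT.
apply/ler_addgt0Pl => e e0; rewrite addr0.
have eB : 0 < e / B by rewrite divr_gt0.
have [p pp fp] := polyfun_dense r n eB (Cinf_smooth f).
have fp' := jet_le_toCinf (smooth_on_polyfun pp) fp.
have Dp : D (toCinf Eall p) = 0.
  have [l ->] := polyfun_monomial pp; rewrite (sum_linear_fun _ _ _ (linear_distr D)).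
  by rewrite big1// => cb _; rewrite D0 scaler0.
have -> : D f = D (f - toCinf Eall p).
  by rewrite (linear_funB f (toCinf Eall p) (linear_distr D)) Dp subr0.
have -> : e = B * (e / B) by rewrite mulrC divfK ?gt_eqF.
apply: KB => //; exact: jet_leS Kr (leqnn _) (lexx _) fp'.
Qed.

End Moments.

(** * Smoothness of x |-> S (f (x .)) *)

Section LimitDerivative.
Context {R : realType}.

(** The mean value theorem for an approximation phi' of phi, with derivative ga',
    gives |phi z - phi 0 - ga 0 z| <= 2 c + |z| (c + e / 2), where c is the accuracy
    of the approximation; c may be chosen after z. *)
Lemma limit_derive1 (phi ga : R -> R) (r : R) : 0 < r ->
  (forall e : R, 0 < e -> exists phi' ga' : R -> R,
     [/\ forall h, is_derive h (1 : R) phi' (ga' h), {for 0, continuous ga'},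
      forall h, `|h| < r -> `|phi h - phi' h| <= e &
      forall h, `|h| < r -> `|ga h - ga' h| <= e]) ->
  is_derive (0 : R) (1 : R) phi (ga 0).
Proof.
move=> r0 app; apply/is_derive1_caratheodory.
exists (fun z => if z == 0 then ga 0 else (phi z - phi 0) / z); split.
- move=> z; rewrite subr0; case: eqVneq => [->|z0]; first by rewrite !subrr mulr0.
  by rewrite divfK.
- rewrite /prop_for/continuous_at eqxx; apply/cvgrPdist_le => e e0.
  have e80 : 0 < e / 8 by rewrite divr_gt0.
  have [ph [g [_ /cvgrPdist_lt/(_ _ e80)/nbhs0P cg _ gag]]] := app _ e80.
  have [q /= q0 qP] : exists2 q : R, 0 < q & forall t, `|t| < q -> `|ga t - ga 0| <= e / 2.
    move/nbhs_ballP: cg => [q /= q0 qP].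
    exists (Num.min q r); first by rewrite lt_min q0.
    move=> t; rewrite lt_min => /andP[tq tr].
    have := qP t; rewrite -ball_normE /= sub0r normrN add0r => /(_ tq).
    have := gag t tr; have := gag 0; rewrite normr0 => /(_ r0).
    rewrite !ler_norml ltr_norml => /andP[? ?] /andP[? ?] /andP[? ?].
    by apply/andP; split; lra.
  near=> z; case: eqVneq => [_|z0]; first by rewrite subrr normr0 ltW.
  have zr : `|z| < Num.min q r.
    by near: z; apply: (@nbhs0_lt R R^o); rewrite lt_min q0.
  move: zr; rewrite lt_min => /andP[zq zr].
  have az0 : 0 < `|z| by rewrite normr_gt0.
  rewrite -(ler_pM2r az0) -normrM mulrBl divfK//.
  (* The accuracy for which 2 c + |z| c = |z| e / 2. *)
  pose c := e * `|z| / (2 * (2 + `|z|)).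
  have c0 : 0 < c by rewrite divr_gt0 ?mulr_gt0 ?addr_gt0.
  have [f [g' [df _ phf gag']]] := app _ c0.
  have [t tz ft] : exists2 t, `|t| <= `|z| & f z - f 0 = g' t * z.
    have cf : continuous f.
      by move=> y; exact/differentiable_continuous/derivable1_diffP.
    have [zlt|zgt] := ltP z 0.
      have [t] := MVT_segment (ltW zlt) (fun x _ => df x) (continuous_subspaceT cf).
      rewrite in_itv/= sub0r => /andP[t1 t2] ft; exists t.
        by rewrite ler0_norm// ltr0_norm//; lra.
      by rewrite -opprB ft mulrN opprK.
    have [t] := MVT_segment zgt (fun x _ => df x) (continuous_subspaceT cf).
    rewrite in_itv/= subr0 => /andP[t1 t2] ft; exists t => //.
    by rewrite !ger0_norm.
  have ht : `|g' t - ga 0| <= c + e / 2.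
    rewrite -(subrK (ga t) (g' t)) -addrA; apply: le_trans (ler_normD _ _) _.
    rewrite lerD//; first by rewrite distrC gag'// (le_lt_trans tz).
    by apply: qP; exact: le_lt_trans zq.
  have -> : ga 0 * z - (phi z - phi 0) =
     (f z - phi z) + (phi 0 - f 0) - (g' t - ga 0) * z.
    by rewrite mulrBl -ft; ring.
  apply: le_trans (ler_normB _ _) _; rewrite normrM.
  have h1 : `|f z - phi z + (phi 0 - f 0)| <= c + c.
    apply: le_trans (ler_normD _ _) _; rewrite lerD//; last by rewrite phf// normr0.
    by rewrite distrC phf.
  have h2 : `|g' t - ga 0| * `|z| <= (c + e / 2) * `|z| by rewrite ler_wpM2r.
  apply: le_trans (lerD h1 h2) _.
  have -> : c + c + (c + e / 2) * `|z| = c * (2 + `|z|) + e / 2 * `|z| by ring.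
  have -> : c * (2 + `|z|) = e / 2 * `|z|.
    by rewrite /c; field; rewrite gt_eqF// addr_gt0.
  by rewrite -mulrDl -splitr.
- by rewrite eqxx.
Unshelve. all: by end_near. Qed.

End LimitDerivative.

Section Hadamard.
Context {R : realType} {d : nat}.
Local Notation E := 'rV[R]_d.
Local Notation C := (R[i]^o).
Local Notation Eall := (@openT_set E).
Implicit Types (Om : openset E) (x y : E) (i : 'I_d) (s : seq 'I_d) (K : set E).
Implicit Types (S T : distr Eall) (al : 'I_d -> nat) (f g : Cinf Eall).

Section Compose.
Variables (Om Om' : openset E) (S : distr Om') (L : Cinf Om -> Cinf Om').
Hypotheses (lL : linear L) (cL : continuous L).

Lemma linear_comp_distr : linear (fun f : Cinf Om => S (L f)).
Proof. by move=> a f g; rewrite lL linear_distr. Qed.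

Lemma continuous_comp_distr : continuous (fun f : Cinf Om => S (L f)).
Proof.
move=> f; apply: (@continuous_comp _ _ _ L S); first exact: cL.
exact: continuous_distr.
Qed.

Definition comp_distr : distr Om := mkdistr linear_comp_distr continuous_comp_distr.
End Compose.

Definition coord_fun i : E -> C := fun y => real_complex R (y 0 i).

Lemma smooth_on_coord_fun i : smooth_on setT (coord_fun i).
Proof. exact/smooth_on_polyfun/polyfun_coord. Qed.

Lemma supp_coord_fun i : supp (coord_fun i) `<=` Eall.
Proof. by move=> ? _. Qed.

(** The distribution y_i S: the derivative of S (f (x .)) along x_i is
    (y_i S) ((d_i f) (x .)). *)
Definition mulcoord i S : distr Eall :=
  comp_distr S (linear_cutmul (smooth_on_coord_fun i) (@supp_coord_fun i))
    (continuous_cutmul (smooth_on_coord_fun i) (@supp_coord_fun i)).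

Definition Cinf_pderiv i f : Cinf Eall := toCinf Eall (pderivs [:: i] f).

Lemma smooth_on_Cinf_pderiv i f : smooth_on setT (pderivs [:: i] f).
Proof. exact: smooth_on_pderivs (Cinf_smooth f). Qed.

Lemma Cinf_pderivE i f x : Cinf_pderiv i f x = pderivs [:: i] f x.
Proof. by rewrite /Cinf_pderiv toCinfTE//; exact: smooth_on_Cinf_pderiv. Qed.

Lemma pderivs_Cinf_pderiv s i f x : pderivs s (Cinf_pderiv i f) x = pderivs (rcons s i) f x.
Proof.
rewrite -cats1 pderivs_cat; apply: (@pderivs_eq_on _ _ setT) => //.
- exact: openT.
- exact: smooth_on_Cinf_pderiv.
- by move=> y _; rewrite Cinf_pderivE.
Qed.

Lemma linear_Cinf_pderiv i : linear (Cinf_pderiv i).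
Proof.
move=> a f g; apply: Cinf_eqP => x _.
rewrite Cinf_pderivE (Cinf_pderivs_lin _ _ _ _ (I : (Eall : set E) x)).
by rewrite -[RHS]/(a *: Cinf_pderiv i f x + Cinf_pderiv i g x) !Cinf_pderivE.
Qed.

(** For S in E'(R^d), the value of T on this function is (T * S) f. *)
Definition hadamard S f : E -> C := fun x => S (dilate Eall x f).

Lemma dilateTE x f y : dilate Eall x f y = f (hmul x y).
Proof. by rewrite dilateE. Qed.

Lemma linear_hadamard S x : linear (fun f => hadamard S f x).
Proof. by move=> a f g; rewrite /hadamard linear_dilate// linear_distr. Qed.

Lemma hadamard_monomial S al x :
  hadamard S (Cinf_monomial al) x = (monomial al x * S (Cinf_monomial al) : R[i]).
Proof.
rewrite -[RHS]/(monomial al x *: S (Cinf_monomial al)) -linear_funZ; last exact: linear_distr.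
congr (S _); apply: Cinf_eqP => y _; rewrite dilateTE Cinf_monomialE monomial_hmul.
by rewrite -[RHS]/(monomial al x * Cinf_monomial al y) Cinf_monomialE.
Qed.

Lemma pderiv_monomial i al x : pderivs [:: i] (monomial al) x =
  real_complex R ((al i)%:R * \prod_j x 0 j ^+ (al j - (j == i))).
Proof.
apply: is_pderiv_val; split => /=; first exact: is_derive_monomial.
exact: (is_derive_cst (0 : R)).
Qed.

Lemma hadamard_Cinf_pderiv_monomial S i al x :
  hadamard (mulcoord i S) (Cinf_pderiv i (Cinf_monomial al)) x =
  (pderivs [:: i] (monomial al) x * S (Cinf_monomial al) : R[i]).
Proof.
set c := pderivs _ _ x.
rewrite -[RHS]/(c *: S (Cinf_monomial al)) -linear_funZ; last exact: linear_distr.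
congr (S _); apply: Cinf_eqP => y _; rewrite cutmulE; [|exact: smooth_on_coord_fun|by []].
rewrite dilateTE Cinf_pderivE -[RHS]/(c * Cinf_monomial al y) Cinf_monomialE.
have -> : pderivs [:: i] (Cinf_monomial al) (hmul x y) = pderivs [:: i] (monomial al) (hmul x y).
  apply: (@pderivs_eq_on _ _ setT) => //; [exact: openT|exact: smooth_on_monomial|].
  by move=> z _; rewrite Cinf_monomialE.
rewrite /c !pderiv_monomial /coord_fun /monomial -!rmorphM; congr (real_complex R _).
have [->|ai] := eqVneq (al i) 0%N; first by rewrite !mul0r mulr0.
rewrite mulrCA -!mulrA; congr (_ * _).
under eq_bigr do rewrite mxE exprMn.
rewrite big_split/= mulrCA; congr (_ * _).
rewrite (bigD1 i)//= [RHS](bigD1 i)//= eqxx mulrA -exprS subn1 prednK ?lt0n//.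
by congr (_ * _); apply: eq_bigr => j /negPf ->; rewrite subn0.
Qed.

(** On a monomial both sides are explicit, so the chain rule needs no differentiation
    under S. *)
Lemma hadamard_polyfun S p : polyfun p -> smooth_on setT (hadamard S (toCinf Eall p)) /\
  forall i x, hadamard (mulcoord i S) (Cinf_pderiv i (toCinf Eall p)) x =
              pderivs [:: i] (hadamard S (toCinf Eall p)) x.
Proof.
move=> /polyfun_monomial[l ->].
pose c (cb : C * ('I_d -> nat)) : R[i] := cb.1 * S (Cinf_monomial cb.2).
have [sh dh] := @smooth_on_sumP R d _ l c (fun cb => monomial cb.2)
   (fun cb => @smooth_on_monomial _ _ setT cb.2).
have hE : hadamard S (\sum_(cb <- l) (cb.1 : R[i]) *: Cinf_monomial cb.2) =
    (fun x => \sum_(cb <- l) (c cb * monomial cb.2 x : R[i])).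
  apply/funext => x; rewrite (sum_linear_fun _ _ _ (linear_hadamard S x)).
  apply: eq_bigr => cb _; rewrite hadamard_monomial /c -[LHS]/(cb.1 * _).
  by rewrite mulrA mulrAC.
split; rewrite hE// => i x; rewrite dh// (sum_linear_fun _ _ _ (linear_Cinf_pderiv i)).
rewrite (sum_linear_fun _ _ _ (linear_hadamard (mulcoord i S) x)).
apply: eq_bigr => cb _; rewrite hadamard_Cinf_pderiv_monomial /c -[LHS]/(cb.1 * _).
by rewrite mulrA mulrAC.
Qed.

Lemma prod_bound x (r : R) s n : 0 <= r -> box r x -> (size s <= n)%N ->
  `|\prod_(i <- s) x 0 i| <= (1 + r) ^+ n.
Proof.
move=> r0 xr sn; apply: (@le_trans _ _ ((1 + r) ^+ size s)); last first.
  by rewrite ler_weXn2l// lerDl.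
elim: s {sn} => [|i s IH]; first by rewrite big_nil normr1.
rewrite big_cons normrM exprS ler_pM//.
by apply: le_trans (xr i) _; rewrite lerDr.
Qed.

Lemma jet_le_dilate Om Om' (f : Cinf Om) x (r e : R) K n :
  (forall y, (Om' : set E) y -> (Om : set E) (hmul x y)) ->
  0 <= r -> box r x -> K `<=` Om' -> jet_le (hmul x @` K) n e f ->
  jet_le K n ((1 + r) ^+ n * e) (dilate Om' x f).
Proof.
move=> xO r0 xr KO fK s y sn Ky; rewrite pderivs_dilate//; last exact: KO.
rewrite [X in cabs X]/(_ *: _)/= cabsM cabs_real ler_pM ?cabs_ge0//.
  exact: prod_bound.
by apply: fK => //; exists y.
Qed.

Lemma hadamard_jet_bounded S (r : R) : 0 <= r -> exists r' n, exists2 B : R, 0 < B &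
  forall x, box r x -> jet_bounded (fun f => hadamard S f x) (box r') n B.
Proof.
move=> r0; have [K [n [B B0 [KO KB]]]] := distr_jet_bounded S.
have [k k0 Kk] := compact_sub_box KO.2.
have r1 : 0 < 1 + r by rewrite ltr_pwDl.
exists (r * k), n, (B * (1 + r) ^+ n); first by rewrite mulr_gt0 ?exprn_gt0.
move=> x xr f e e0 fK; rewrite -mulrA; apply: KB; first by rewrite mulr_gt0 ?exprn_gt0.
apply: jet_le_dilate => //.
move=> s _ sn [y Ky <-]; apply: fK => // i; rewrite mxE normrM ler_pM//.
exact: Kk.
Qed.

Lemma hadamard_close S (r e : R) : 0 <= r -> 0 < e ->
  exists r' n, exists2 e' : R, 0 < e' & forall f g,
    jet_le (box r') n e' (f - g : Cinf Eall) ->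
    forall x, box r x -> cabs (hadamard S f x - hadamard S g x) <= e.
Proof.
move=> r0 e0; have [r' [n [B B0 BP]]] := hadamard_jet_bounded S r0.
have eB : 0 < e / B by rewrite divr_gt0.
exists r', n, (e / B) => // f g fg x xr.
rewrite -(linear_funB f g (linear_hadamard S x)).
have -> : e = B * (e / B) by rewrite mulrC divfK ?gt_eqF.
exact: BP.
Qed.

(** One polynomial approximates f so well that both S (f (x .)) and its expected
    derivative along x_i are approximated, uniformly for x in a box. *)
Lemma hadamard_approx S i f (r e : R) : 0 <= r -> 0 < e ->
  exists2 p, polyfun p & forall x, box r x ->
    cabs (hadamard S f x - hadamard S (toCinf Eall p) x) <= e /\
    cabs (hadamard (mulcoord i S) (Cinf_pderiv i f) x -
          hadamard (mulcoord i S) (Cinf_pderiv i (toCinf Eall p)) x) <= e.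
Proof.
move=> r0 e0; have [r1 [n1 [e1 e10 h1]]] := hadamard_close S r0 e0.
have [r2 [n2 [e2 e20 h2]]] := hadamard_close (mulcoord i S) r0 e0.
have e120 : 0 < Num.min e1 e2 by rewrite lt_min e10.
have [p pp fp] := polyfun_dense (Num.max r1 r2) (n1 + n2).+1 e120 (Cinf_smooth f).
exists p => // x xr.
have {}fp := jet_le_toCinf (smooth_on_polyfun pp) fp.
have bS (k k' : R) : k <= k' -> box k `<=` (box k' : set E).
  by move=> kk y yk j; exact: le_trans (yk j) kk.
split.
  apply: h1 => //; apply: jet_leS fp.
  - by apply: bS; rewrite le_max lexx.
  - by rewrite (leq_trans (leq_addr n2 n1)).
  - by rewrite ge_min lexx.
apply: h2 => // s y sn yr; rewrite -linear_funB; last exact: linear_Cinf_pderiv.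
rewrite pderivs_Cinf_pderiv; apply: le_trans (fp _ _ _ _) _.
- by rewrite size_rcons ltnS (leq_trans sn)// leq_addl.
- by apply: bS yr; rewrite le_max lexx orbT.
- by rewrite ge_min lexx orbT.
Qed.

(** True for polynomials by [hadamard_polyfun], and preserved by the uniform limits
    of [hadamard_approx] thanks to [limit_derive1]. *)
Lemma hadamard_pderiv S f i x :
  is_pderiv i (hadamard S f) x (hadamard (mulcoord i S) (Cinf_pderiv i f) x).
Proof.
have [k k0 xk] := compact_sub_box (@compact_set1 _ x).
have {}xk : box k x by exact: xk.
have k1 : 0 <= k + 1 by rewrite addr_ge0// ltW.
have near_box (h : R) : `|h| < 1 -> box (k + 1) (h *: delta_mx 0 i + x : E).
  move=> h1 j; rewrite !mxE /= addrC (le_trans (ler_normD _ _))//.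
  rewrite lerD ?xk// normrM; case: (j == i); rewrite /= ?normr1 ?normr0 ?mulr1 ?mulr0//.
  exact: ltW.
have approx (e : R) : 0 < e -> exists u : E -> C, [/\ smooth_on setT u,
    forall h : R, `|h| < 1 ->
      cabs (hadamard S f (h *: delta_mx 0 i + x) - u (h *: delta_mx 0 i + x)) <= e &
    forall h : R, `|h| < 1 ->
      cabs (hadamard (mulcoord i S) (Cinf_pderiv i f) (h *: delta_mx 0 i + x) -
       pderivs [:: i] u (h *: delta_mx 0 i + x)) <= e].
  move=> e0; have [p pp pP] := hadamard_approx S i f k1 e0.
  have [sp dp] := hadamard_polyfun S pp; exists (hadamard S (toCinf Eall p)); split => // h h1.
    exact: (pP _ (near_box h h1)).1.
  by rewrite -dp; exact: (pP _ (near_box h h1)).2.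
have ReB (z w : R[i]) : complex.Re (z - w) = complex.Re z - complex.Re w by case: z w => ? ? [].
have ImB (z w : R[i]) : complex.Im (z - w) = complex.Im z - complex.Im w by case: z w => ? ? [].
have dd (u : E -> C) t y : smooth_on setT u -> is_pderiv i (pderivs t u) y (pderivs (i :: t) u y).
  by move=> su; exact: smooth_on_pderiv su t i y I.
split; apply/is_derive_line.
  have := @limit_derive1 R (fun h => complex.Re (hadamard S f (h *: delta_mx 0 i + x)))
    (fun h => complex.Re (hadamard (mulcoord i S) (Cinf_pderiv i f)
      (h *: delta_mx 0 i + x))) 1 ltr01.
  rewrite scale0r add0r; apply => e /approx[u [su u0 u1]].
  exists (fun h => complex.Re (u (h *: delta_mx 0 i + x))),
    (fun h => complex.Re (pderivs [:: i] u (h *: delta_mx 0 i + x))); split.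
  - by move=> h; apply: (@is_derive_along _ _ (fun y => complex.Re (u y))
      (fun y => complex.Re (pderivs [:: i] u y))) => y; exact: (dd u [::] y su).1.
  - apply/differentiable_continuous/derivable1_diffP.
    have [] := @is_derive_along _ _ (fun y => complex.Re (pderivs [:: i] u y))
      (fun y => complex.Re (pderivs [:: i; i] u y)) (delta_mx 0 i) x 0
      (fun y => (dd u [:: i] y su).1); by [].
  - by move=> h h1; rewrite -ReB; apply: le_trans (Re_le_cabs _) _; exact: u0.
  - by move=> h h1; rewrite -ReB; apply: le_trans (Re_le_cabs _) _; exact: u1.
have := @limit_derive1 R (fun h => complex.Im (hadamard S f (h *: delta_mx 0 i + x)))
  (fun h => complex.Im (hadamard (mulcoord i S) (Cinf_pderiv i f) (h *: delta_mx 0 i + x))) 1 ltr01.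
rewrite scale0r add0r; apply => e /approx[u [su u0 u1]].
exists (fun h => complex.Im (u (h *: delta_mx 0 i + x))),
  (fun h => complex.Im (pderivs [:: i] u (h *: delta_mx 0 i + x))); split.
- by move=> h; apply: (@is_derive_along _ _ (fun y => complex.Im (u y))
    (fun y => complex.Im (pderivs [:: i] u y))) => y; exact: (dd u [::] y su).2.
- apply/differentiable_continuous/derivable1_diffP.
  have [] := @is_derive_along _ _ (fun y => complex.Im (pderivs [:: i] u y))
    (fun y => complex.Im (pderivs [:: i; i] u y)) (delta_mx 0 i) x 0
    (fun y => (dd u [:: i] y su).2); by [].
- by move=> h h1; rewrite -ImB; apply: le_trans (Im_le_cabs _) _; exact: u0.
- by move=> h h1; rewrite -ImB; apply: le_trans (Im_le_cabs _) _; exact: u1.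
Qed.
End Hadamard.

Section HadamardSmooth.
Context {R : realType} {d : nat}.
Local Notation E := 'rV[R]_d.
Local Notation C := (R[i]^o).
Local Notation Eall := (@openT_set E).
Implicit Types (Om : openset E) (x y : E) (i : 'I_d) (s : seq 'I_d) (K : set E).
Implicit Types (S T : distr Eall) (al : 'I_d -> nat) (f g : Cinf Eall).

Lemma hadamard_continuous S f : continuous (hadamard S f).
Proof.
move=> x; apply/continuous_cabsP => e e0.
have [k k0 xk] := compact_sub_box (@compact_set1 _ x).
have {}xk : box k x by exact: xk.
have k1 : 0 <= k + 1 by rewrite addr_ge0// ltW.
have e40 : 0 < e / 4 by rewrite divr_gt0.
have [r [n [e' e'0 fP]]] := hadamard_close S k1 e40.
have [p pp fp] := polyfun_dense r n e'0 (Cinf_smooth f).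
have {}fP := fP _ _ (jet_le_toCinf (smooth_on_polyfun pp) fp).
have [sp _] := hadamard_polyfun S pp.
have /continuous_cabsP/(_ _ e40) px := (sp [::] x I).1.
have FF : Filter (nbhs x) by exact: nbhs_filter.
apply: filterS (filterI px (near_coord x ltr01)) => y [yp xy].
have xk1 : box (k + 1) x by move=> j; rewrite (le_trans (xk j))// lerDl.
have yk1 : box (k + 1) y.
  move=> j; rewrite -[y 0 j](subKr (x 0 j)); apply: le_trans (ler_normB _ _) _.
  by rewrite lerD ?xk// ltW.
have h1 := fP x xk1; have h2 := fP y yk1.
set u := hadamard S (toCinf Eall p) in yp h1 h2.
rewrite /= in yp.
have -> : hadamard S f x - hadamard S f y =
  (hadamard S f x - u x) + ((u x - u y) + (u y - hadamard S f y)) by ring.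
rewrite cabsB in h2.
have := cabsD (hadamard S f x - u x) ((u x - u y) + (u y - hadamard S f y)).
have := cabsD (u x - u y) (u y - hadamard S f y); lra.
Qed.

(** Iterating [hadamard_pderiv], each derivative is again a function of the same
    kind, for another distribution and another smooth function. *)
Lemma hadamard_smoothP S f : smooth_on setT (hadamard S f) /\
  forall s x, setT x -> pderivs s (hadamard S f) x =
    hadamard (foldr mulcoord S s) (foldr Cinf_pderiv f s) x.
Proof.
apply: (@smooth_onP _ _ setT _
  (fun s => hadamard (foldr mulcoord S s) (foldr Cinf_pderiv f s))) => //.
- exact: openT.
- by move=> s x _; exact: hadamard_continuous.
- by move=> s i x _; exact: hadamard_pderiv.
Qed.

Lemma pderivs_foldr_Cinf_pderiv s t f x :
  pderivs t (foldr Cinf_pderiv f s) x = pderivs (t ++ s) f x.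
Proof.
elim: s t => [|i s IH] t /=; first by rewrite cats0.
by rewrite pderivs_Cinf_pderiv IH cat_rcons.
Qed.

Definition hadamard_Cinf S f : Cinf Eall := toCinf Eall (hadamard S f).

Lemma hadamard_CinfE S f x : hadamard_Cinf S f x = hadamard S f x.
Proof. by rewrite /hadamard_Cinf toCinfTE//; exact: (hadamard_smoothP S f).1. Qed.

Lemma linear_hadamard_Cinf S : linear (hadamard_Cinf S).
Proof.
move=> a f g; apply: Cinf_eqP => x _; rewrite hadamard_CinfE linear_hadamard.
by rewrite -[RHS]/(a *: hadamard_Cinf S f x + hadamard_Cinf S g x) !hadamard_CinfE.
Qed.

Lemma continuous_hadamard_Cinf S : continuous (hadamard_Cinf S).
Proof.
apply: (continuous_jet_bounded_map (linear_hadamard_Cinf S)) => s K' [_ cK'].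
have [r r0 K'r] := compact_sub_box cK'.
have [r' [n [B B0 BP]]] := hadamard_jet_bounded (foldr mulcoord S s) (ltW r0).
exists (box r'), (n + size s)%N, B => //; split.
  by split; [move=> ? _|exact: compact_box].
move=> x Kx f e e0 fK.
have [sh hE] := hadamard_smoothP S f.
have -> : pderivs s (hadamard_Cinf S f) x = pderivs s (hadamard S f) x.
  apply: (@pderivs_eq_on _ _ setT) => //; first exact: openT.
  by move=> y _; rewrite hadamard_CinfE.
rewrite hE//; apply: (BP x (K'r x Kx)) => // t y tn yr.
rewrite pderivs_foldr_Cinf_pderiv; apply: fK => //.
by rewrite size_cat leq_add2r.
Qed.

Lemma star_hadamard_Cinf S T f : star T S f = T (hadamard_Cinf S f).
Proof. by []. Qed.

(** x^al is multiplicative: (x y)^al = x^al y^al. *)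
Lemma star_monomial S T al :
  star T S (Cinf_monomial al) = (T (Cinf_monomial al) * S (Cinf_monomial al) : R[i]).
Proof.
rewrite star_hadamard_Cinf
  (_ : hadamard_Cinf S (Cinf_monomial al) = S (Cinf_monomial al) *: Cinf_monomial al).
  by rewrite linear_funZ; [rewrite mulrC|exact: linear_distr].
apply: Cinf_eqP => x _; rewrite hadamard_CinfE hadamard_monomial mulrC.
by rewrite -[RHS]/(S (Cinf_monomial al) * Cinf_monomial al x) Cinf_monomialE.
Qed.

End HadamardSmooth.

(** * Operators with monomial eigenvectors *)

Section Main.
Context {R : realType} {d : nat}.
Local Notation E := 'rV[R]_d.
Local Notation C := (R[i]^o).
Local Notation Eall := (@openT_set E).
Variables (Om Om' : openset E) (M : {linear Cinf Om -> Cinf Om'}).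
Hypothesis cM : continuous M.
Implicit Types (T : distr Eall) (al : 'I_d -> nat) (x y : E) (S : distr Om').

Lemma linearM : linear M.
Proof. by move=> a f g; rewrite linearP. Qed.

Lemma linear_eval (O : openset E) x : linear (fun f : Cinf O => f x).
Proof. by []. Qed.

Lemma continuous_eval (O : openset E) x : (O : set E) x ->
  continuous (fun f : Cinf O => f x : C).
Proof.
move=> Ox; apply: (@jet_bounded_continuous _ _ O _ [set x] 0%N 1) => //.
- by split; [move=> _ ->|exact: compact_set1].
- by move=> f e e0 fK; rewrite mul1r; exact: (fK [::] x).
Qed.

Definition evaluation (O : openset E) x (Ox : (O : set E) x) : distr O :=
  mkdistr (@linear_eval O x) (continuous_eval Ox).

(** The transpose of M, on distributions. *)
Definition precomp (S : distr Om') : distr Om := comp_distr S linearM cM.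

Lemma linear_precomp : linear precomp.
Proof. by move=> a S S'; apply: distr_eq => f. Qed.

Lemma tvs_bounded_image (B : set (Cinf Om)) : tvs_bounded B -> tvs_bounded (M @` B).
Proof.
move=> bB U U0; have : nbhs (0 : Cinf Om) (M @^-1` U).
  by apply: cM; rewrite linear0.
move=> /bB[r r0 rB]; exists r => // a ra _ [f Bf <-].
have [g Ug <-] := rB a ra f Bf.
by exists (M g) => //; rewrite linearZ.
Qed.

(** M maps bounded sets to bounded sets. *)
Lemma continuous_precomp : continuous precomp.
Proof.
move=> S; have FF : Filter (nbhs S) by exact: nbhs_filter.
apply/initial_cvg; apply/fam_cvgP => B bB.
have /initial_cvg/fam_cvgP h : nbhs S --> S by [].
have hB := h _ (tvs_bounded_image bB).
move=> U /uniform_nbhs[W [entW WU]].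
suff h' : nbhs S [set S' : distr Om' | U (strong_dual_family (precomp S'))] by exact: h'.
have h3 : nbhs S [set S' : distr Om' | forall g, (M @` B) g -> W (S g, S' g)].
  apply: (hB [set k | forall g, (M @` B) g -> W (S g, k g)]).
  by apply/uniform_nbhs; exists W; split.
apply: filterS h3 => S' SW; apply: WU => f Bf; apply: SW; by exists f.
Qed.

HB.instance Definition _ := GRing.isLinear.Build R[i] (distr Om') (distr Om) *:%R
  precomp linear_precomp.

(** Apply the transposition identity to the Dirac measure at x. Both sides are then
    distributions on Om, and they are compared after extension to R^d, where both
    are f |-> T (f (x .)). *)
Lemma star_to_multiplier T : distr_in (dilation_set Om' Om) T ->
  forall N : {linear distr Om' -> distr Om}, is_star_operator T N ->
  (forall f : Cinf Om, bidual_map (M f) = transpose N (bidual_map f)) ->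
  is_multiplier_operator T M.
Proof.
move=> [_ TV] N [_ NT] MN x Ox.
have [Tx TxT] : exists Tx : distr (dilate_set Om x), extend Tx = T.
  apply: localize => eta /TV /(_ (hmul eta x)) h.
  by rewrite hmulC in h *; apply: h; exists x => //; rewrite hmulC.
exists Tx => // f.
have xO y : (dilate_set Om x : set E) y -> (Om : set E) (hmul x y) by [].
pose B : distr Om := comp_distr Tx (linear_dilate xO) (continuous_dilate xO).
rewrite -[LHS]/(evaluation Ox (M f)) -[RHS]/(B f).
have -> : evaluation Ox (M f) = N (evaluation Ox) f.
  exact: (congr1 (fun u => u (evaluation Ox)) (MN f)).
suff -> : N (evaluation Ox) = B by [].
apply: extend_inj; apply: distr_eq => g.
rewrite NT; pose h := dilate Eall x g.
have E0 : (fun u => extend (evaluation Ox) (toCinf Eall (fun y => g (hmul u y)))) = g \o hmul x.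
  apply/funext => u; rewrite -[LHS]/(restr Om' (dilate Eall u g) x) restrE; last exact/mem_set.
  by rewrite dilateTE/= hmulC.
have -> : star T (extend (evaluation Ox)) g = T h by rewrite /star E0.
rewrite -TxT -[LHS]/(Tx (restr _ h)) -[RHS]/(Tx (dilate _ x (restr Om g))).
congr (strong_dual_fun Tx _); apply: Cinf_eqP => u uO.
rewrite restrE// dilateTE dilateE//; last exact/set_mem.
by rewrite restrE//; apply/mem_set; exact/xO/set_mem.
Qed.

(** The eigenvalues of M are the moments of T. *)
Definition has_moments T := forall al,
  M (toCinf Om (monomial al)) = T (Cinf_monomial al) *: toCinf Om' (monomial al).

Lemma multiplier_has_moments T : is_multiplier_operator T M -> has_moments T.
Proof.
move=> TM al; apply: Cinf_eqP => x /set_mem Ox.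
have [Tx <- ->] := TM x Ox.
rewrite -[RHS]/(Tx (restr _ (Cinf_monomial al)) * toCinf Om' (monomial al) x).
rewrite toCinfE; [|exact: smooth_on_monomial|exact/mem_set].
rewrite mulrC -[RHS]/(monomial al x *: _) -linear_funZ; last exact: linear_distr.
congr (strong_dual_fun Tx _).
have xO y : (dilate_set Om x : set E) y -> (Om : set E) (hmul x y) by [].
apply: Cinf_eqP => y yO; have Oy := xO y (set_mem yO).
rewrite -[LHS]/(dilate (dilate_set Om x) x (toCinf Om (monomial al)) y) (dilateE xO _ (set_mem yO)).
rewrite (toCinfE (@smooth_on_monomial _ _ Om al) (mem_set Oy)).
rewrite -[RHS]/(monomial al x * restr _ (Cinf_monomial al) y) restrE//.
by rewrite Cinf_monomialE monomial_hmul.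
Qed.

(** Both sides are distributions in f with the moments T(y^al) x^al. *)
Lemma has_moments_eval T x f : has_moments T -> (Om' : set E) x ->
  M (restr Om f) x = T (dilate Eall x f).
Proof.
move=> TM Ox.
have xT y : (Eall : set E) y -> (Eall : set E) (hmul x y) by [].
suff : extend (precomp (evaluation Ox)) = comp_distr T (linear_dilate xT) (continuous_dilate xT).
  by move/(congr1 (fun S : distr Eall => S f)).
apply: moments_determine => al.
rewrite -[LHS]/(M (restr Om (Cinf_monomial al)) x).
rewrite -[RHS]/(hadamard T (Cinf_monomial al) x) hadamard_monomial restr_monomial TM.
rewrite -[LHS]/(T (Cinf_monomial al) * toCinf Om' (monomial al) x) toCinfE; first by rewrite mulrC.
  exact: smooth_on_monomial.
exact/mem_set.
Qed.

(** Both sides are distributions with the moments T(y^al) S(y^al). *)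
Lemma has_moments_star T S : has_moments T -> extend (precomp S) =1 star T (extend S).
Proof.
move=> TM f; pose D : distr Eall := comp_distr T
  (linear_hadamard_Cinf (extend S)) (@continuous_hadamard_Cinf _ _ (extend S)).
rewrite star_hadamard_Cinf -[RHS]/(D f); congr (strong_dual_fun _ f).
apply: moments_determine => al.
rewrite -[RHS]/(star T (extend S) (Cinf_monomial al)) star_monomial.
rewrite -[LHS]/(S (M (restr Om (Cinf_monomial al)))) restr_monomial TM.
rewrite linear_funZ; last exact: linear_distr.
by rewrite -[X in _ = _ * X]/(S (restr Om' (Cinf_monomial al))) restr_monomial.
Qed.

Lemma nonzero_near x (e : R) : 0 < e ->
  exists z : E, (forall i, `|x 0 i - z 0 i| <= e) /\ forall i, z 0 i != 0.
Proof.
move=> e0; exists (\row_i (if x 0 i == 0 then e else x 0 i)); split=> i; rewrite mxE.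
  by case: eqP => [->|_]; [rewrite sub0r normrN gtr0_norm|rewrite subrr normr0 ltW].
by case: (eqVneq (x 0 i) 0) => [_|//]; rewrite gt_eqF.
Qed.

Definition hmul_inv (z : E) : E := \row_i (z 0 i)^-1.

Lemma hmul_invK (z y : E) : (forall i, z 0 i != 0) -> hmul z (hmul (hmul_inv z) y) = y.
Proof. by move=> z0; apply/rowP => i; rewrite !mxE mulVKf. Qed.

Lemma hmul_Kinv (z y : E) : (forall i, z 0 i != 0) -> hmul (hmul_inv z) (hmul z y) = y.
Proof. by move=> z0; apply/rowP => i; rewrite !mxE mulKf. Qed.

Lemma dilate_dilate (z w : E) (f : Cinf Eall) y : (forall y, hmul z (hmul w y) = y) ->
  dilate Eall w (dilate Eall z f) y = f y.
Proof. by move=> zw; rewrite !dilateTE zw. Qed.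

(** As z is invertible, T f = (M (f (z^-1 .))) z is carried by z^-1 K. *)
Lemma has_moments_supp T (z : E) K n (B : R) : has_moments T -> (Om' : set E) z ->
  (forall i, z 0 i != 0) -> compactly_in Om K -> 0 < B ->
  jet_bounded (fun f => M f z) K n B ->
  forall eta, distr_supp T eta -> K (hmul z eta).
Proof.
move=> TM Oz z0 [KO cK] B0 MK eta Teta.
have [r r0 zr] := compact_sub_box (@compact_set1 _ (hmul_inv z)).
have {}zr : box r (hmul_inv z) by exact: zr.
have cK' : compact (hmul (hmul_inv z) @` K) by exact: compact_hmul.
have r1 : 0 < (1 + r) ^+ n by rewrite exprn_gt0// addr_gt0.
have TK : jet_bounded T (hmul (hmul_inv z) @` K) n (B * (1 + r) ^+ n).
  move=> f e e0 fK.
  have -> : T f = M (restr Om (dilate Eall (hmul_inv z) f)) z.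
    rewrite (has_moments_eval _ TM Oz); congr (strong_dual_fun T _); apply: Cinf_eqP => y _.
    by rewrite dilate_dilate// => u; exact: hmul_Kinv.
  rewrite -mulrA; apply: MK; first by rewrite mulr_gt0.
  have hK : jet_le K n ((1 + r) ^+ n * e) (dilate Eall (hmul_inv z) f).
    by apply: jet_le_dilate => //; exact: ltW.
  move=> s x sn Kx; have <- : pderivs s (dilate Eall (hmul_inv z) f) x =
      pderivs s (restr Om (dilate Eall (hmul_inv z) f)) x; last exact: hK.
  apply/esym/(@pderivs_eq_on _ _ Om); last exact: KO.
  - exact: openset_open.
  - exact: smooth_onS (Cinf_smooth _).
  - by move=> y Oy; rewrite restrE//; exact/mem_set.
have [|k Kk <-] := distr_supp_carrier _ cK' TK Teta; first by rewrite mulr_gt0.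
by rewrite hmul_invK.
Qed.

(** If x eta were outside the compact set K of [jet_bounded_map], so would z eta for
    some z near x without zero coordinate, against [has_moments_supp]. *)
Lemma has_moments_distr_in T : has_moments T -> distr_in (dilation_set Om' Om) T.
Proof.
move=> TM; split; first exact: compact_distr_supp.
move=> eta Teta _ [x Ox <-].
have [e e0 eO] : exists2 e : R, 0 < e &
    forall y, (forall i, `|x 0 i - y 0 i| < e) -> (Om' : set E) y.
  by apply: nearP_coord; apply: open_nbhs_nbhs; split => //; exact: openset_open.
pose L := [set y : E | forall i, `[x 0 i - e / 2, x 0 i + e / 2]%classic (y 0 i)].
have LP y : L y <-> forall i, `|x 0 i - y 0 i| <= e / 2.
  by split=> Ly i; have := Ly i; rewrite /= in_itv/= ler_norml => /andP[? ?];
    apply/andP; split; lra.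
have cL : compact L.
  apply: (@rV_compact R d (fun i => `[x 0 i - e / 2, x 0 i + e / 2]%classic)) => i.
  exact: segment_compact.
have LO : L `<=` Om'.
  move=> y /LP Ly; apply: eO => i; apply: le_lt_trans (Ly i) _.
  by rewrite ltr_pdivrMr//; lra.
have [K [n [B B0 [[KO cK] KB]]]] := jet_bounded_map linearM cM (conj LO cL).
apply: (KO _); apply: contrapT => nK.
have oK : open (~` K).
  by apply: closed_openC; apply: compact_closed cK; exact: norm_hausdorff.
have : \forall z \near x, (~` K) (hmul eta z).
  by apply: (@hmul_continuous _ _ eta x); apply: open_nbhs_nbhs; split.
move/nearP_coord => [e' e'0 e'K].
have m0 : 0 < Num.min (e / 2) (e' / 2) by rewrite lt_min !divr_gt0.
have [z [zx z0]] := nonzero_near x m0.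
have Lz : L z by apply/LP => i; apply: le_trans (zx i) _; rewrite ge_min lexx.
apply: (e'K z).
  move=> i; apply: le_lt_trans (zx i) _; rewrite gt_min; apply/orP; right.
  by rewrite ltr_pdivrMr//; lra.
rewrite hmulC; apply: (has_moments_supp TM (LO z Lz) z0 (conj KO cK) B0 _ Teta).
exact: KB.
Qed.

(** At a point z of Om' without zero coordinate, T f = (M (f (z^-1 .))) z. *)
Lemma has_moments_exists :
  (forall al, exists m : R[i], M (toCinf Om (monomial al)) = m *: toCinf Om' (monomial al)) ->
  exists T, has_moments T.
Proof.
move=> /choice[m mP].
have [[x Ox]|nO] := pselect (exists x, (Om' : set E) x); last first.
  exists 0 => al; apply: Cinf_eqP => x /set_mem Ox.
  by exfalso; apply: nO; exists x.
have [e e0 eO] : exists2 e : R, 0 < e &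
    forall y, (forall i, `|x 0 i - y 0 i| < e) -> (Om' : set E) y.
  by apply: nearP_coord; apply: open_nbhs_nbhs; split => //; exact: openset_open.
have [|z [zx z0]] := @nonzero_near x (e / 2); first by rewrite divr_gt0.
have Oz : (Om' : set E) z.
  by apply: eO => i; apply: le_lt_trans (zx i) _; rewrite ltr_pdivrMr//; lra.
have zT y : (Eall : set E) y -> (Eall : set E) (hmul (hmul_inv z) y) by [].
exists (comp_distr (extend (precomp (evaluation Oz))) (linear_dilate zT) (continuous_dilate zT)).
move=> al; rewrite mP; congr (_ *: _).
pose S := extend (precomp (evaluation Oz)).
rewrite -[RHS]/(hadamard S (Cinf_monomial al) (hmul_inv z)) hadamard_monomial.
rewrite -[X in _ = _ * X]/(M (restr Om (Cinf_monomial al)) z) restr_monomial mP.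
rewrite -[X in _ = _ * X]/(m al * toCinf Om' (monomial al) z).
rewrite toCinfE; [|exact: smooth_on_monomial|exact/mem_set].
rewrite mulrCA -monomial_hmul.
rewrite (_ : monomial al _ = 1) ?mulr1// /monomial big1 ?rmorph1// => i _.
by rewrite !mxE mulVf// expr1n.
Qed.

End Main.

Theorem theorem2p1 (R : realType) (d : nat) (Om Om' : openset 'rV[R]_d)
    (M : {linear Cinf Om -> Cinf Om'}) (M_continuous : continuous M) :
  [<->
    exists2 T, distr_in (dilation_set Om' Om) T &
      exists2 N : {linear distr Om' -> distr Om}, is_star_operator T N &
        forall f : Cinf Om, bidual_map (M f) = transpose N (bidual_map f);
    exists2 T, distr_in (dilation_set Om' Om) T & is_multiplier_operator T M;
    forall al : 'I_d -> nat, exists m : R[i],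
      M (toCinf Om (monomial al)) = m *: toCinf Om' (monomial al)].
Proof.
tfae.
- move=> [T TV [N NT MN]]; exists T => //.
  exact: (star_to_multiplier TV NT MN).
- move=> [T _ TM] al; exists (T (Cinf_monomial al)); exact: multiplier_has_moments.
- move=> /(has_moments_exists M_continuous)[T TM]; exists T; first exact: has_moments_distr_in.
  exists (precomp M_continuous) => //; split; first exact: continuous_precomp.
  by move=> S; exact: has_moments_star.
Qed.
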